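(* Let $\mathcal{A}$ be a (not necessarily self-adjoint) unital operator algebra. The following assertions are equivalent: (i) $\mathcal{A}$ is residually finite dimensional (RFD); (ii) the set of finite dimensional matrix states of $\mathcal{A}$ is weak-$*$ dense in the matrix state space $S(\mathcal{A})$, i.e. for every $n \ge 1$ the set of finite dimensional matrix states $\mathcal{A} \to M_n$ is weak-$*$ dense in $S_n(\mathcal{A})$; (iii) for every representation $\pi: \mathcal{A} \to B(\mathcal{H})$ on a Hilbert space $\mathcal{H}$, there exists a net $(\pi_\lambda)$ of finite dimensional representations $\pi_\lambda: \mathcal{A} \to B(\mathcal{H})$ such that $(\pi_\lambda(a))$ converges to $\pi(a)$ in the weak operator topology (WOT) for all $a \in \mathcal{A}$.
   Context: An operator algebra is a norm closed (not necessarily self-adjoint) subalgebra $\mathcal{A} \subset B(\mathcal{K})$ for some complex Hilbert space $\mathcal{K}$; it is unital if $I_{\mathcal{K}} \in \mathcal{A}$. The space $M_n(\mathcal{A})$ is normed as a subspace of $M_n(B(\mathcal{K})) = B(\mathcal{K}^n)$. A representation of $\mathcal{A}$ is a (not necessarily unital) completely contractive homomorphism $\pi: \mathcal{A} \to B(\mathcal{H})$ for some Hilbert space $\mathcal{H}$; $\pi^{(n)}$ denotes the entrywise application of $\pi$ to $n \times n$ matrices. $\mathcal{A}$ is residually finite dimensional (RFD) if for every $n \in \mathbb{N}$ and every $a \in M_n(\mathcal{A})$, $\|a\| = \sup \|\pi^{(n)}(a)\|$, where the supremum is over all representations $\pi: \mathcal{A} \to B(\mathcal{H})$ with $\dim \mathcal{H}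 < \infty$. A representation $\pi: \mathcal{A} \to B(\mathcal{H})$ is finite dimensional if the closed linear span of $C^*(\pi(\mathcal{A}))\mathcal{H}$ is finite dimensional, where $C^*(\pi(\mathcal{A}))$ is the $C^*$-algebra generated by $\pi(\mathcal{A})$ (for unital $\mathcal{A}$ this means that $\pi(1)\mathcal{H}$ is finite dimensional; $\mathcal{H}$ itself may be infinite dimensional). Write $M_n = M_n(\mathbb{C})$. A matrix state of $\mathcal{A}$ is a unital completely contractive (u.c.c.) linear map $\varphi: \mathcal{A} \to M_n$ for some $n$; $S_n(\mathcal{A})$ is the set of all u.c.c. linear maps $\mathcal{A} \to M_n$, and the matrix state space is $S(\mathcal{A}) = (S_n(\mathcal{A}))_{n=1}^\infty$. $S_n(\mathcal{A})$ is identified with a subset of $M_n(\mathcal{A}')$, where $\mathcal{A}'$ is the dual space of $\mathcal{A}$, and $M_n(\mathcal{A}')$ carries the product topology of the weak-$*$ topology on $\mathcal{A}'$ (called the weak-$*$ topology). A matrix state $\varphi: \mathcal{A} \to M_n$ is finite dimensional if there exist a finite dimensional Hilbert space $\mathcal{H}$, an isometry $w: \mathbb{C}^n \to \mathcal{H}$ and a unital completely contractive homomorphism $\pi: \mathcal{A} \to B(\mathcal{H})$ with $\varphi(a) = w^* \pi(a) w$ for all $a \in \mathcal{A}$. *)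

(* Defs.v *)
From HB Require Import structures.
From mathcomp Require Import all_boot all_order all_algebra.
From mathcomp Require Import all_classical all_reals all_analysis.
From mathcomp Require Import complex.

Set Implicit Arguments.
Unset Strict Implicit.
Unset Printing Implicit Defensive.

Import Order.TTheory GRing.Theory Num.Theory numFieldNormedType.Exports.

Local Open Scope classical_set_scope.
Local Open Scope ring_scope.
Local Open Scope complex_scope.

(* Complex Hilbert spaces: Banach spaces over R[i] whose norm comes from an
   inner product, linear in its first argument. Positive definiteness of hdot
   follows from hdot_norm. *)
HB.mixin Record isHilbert (R : realType) H & CompleteNormedModule R[i] H := {
  hdot : H -> H -> R[i] ;
  hdot_linearl : forall y, scalar (hdot^~ y) ;
  hdot_conj : forall x y, hdot x y = (hdot y x)^* ;
  hdot_norm : forall x : H, hdot x x = `|x| ^+ 2 }.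

#[short(type="hilbertType")]
HB.structure Definition Hilbert (R : realType) :=
  {H of isHilbert R H & CompleteNormedModule R[i] H}.

(* The norm of a normed R[i]-module takes its values in R[i]; this is the same
   number seen in R. *)
Definition rnorm (R : realType) (V : normedModType R[i]) (x : V) : R :=
  complex.Re `|x|.

Section BoundedOperators.
Context {R : realType} (H : hilbertType R).

Definition bounded_op : {pred H -> H} := fun f => `[<linear f /\ continuous f>].

Lemma bounded_op_submod : GRing.submod_closed bounded_op.
Proof.
split=> [|c f g /asboolP[fl fc] /asboolP[gl gc]]; apply/asboolP; split.
- by move=> c x y; rewrite /= scaler0 addr0.
- exact: cst_continuous.
- move=> b x y; rewrite !fctE fl gl !scalerDr !scalerA mulrC -!addrA.
  by congr (_ + _); rewrite addrCA.
- move=> x; apply: continuousD; last exact: gc.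
  by apply: continuousZl_tmp; exact: fc.
Qed.

HB.instance Definition _ :=
  GRing.isSubmodClosed.Build R[i] (H -> H) bounded_op bounded_op_submod.

(* B(H), with pointwise linear structure; the product is composition *)
Record bop := Bop { bop_fun :> H -> H ; bop_funP : bop_fun \in bounded_op }.

HB.instance Definition _ := [isSub for bop_fun].
HB.instance Definition _ := [Choice of bop by <:].
HB.instance Definition _ := [SubChoice_isSubLmodule of bop by <:].

Lemma bop_linear (T : bop) : linear T.
Proof. by have /asboolP[] := bop_funP T. Qed.

Lemma bop_continuous (T : bop) : continuous T.
Proof. by have /asboolP[] := bop_funP T. Qed.

Lemma bounded_op_id : idfun \in bounded_op.
Proof. by apply/asboolP; split=> // x; apply: cvg_id. Qed.

Lemma bounded_op_comp (S T : bop) : S \o T \in bounded_op.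
Proof.
apply/asboolP; split; first by move=> c x y; rewrite /= !bop_linear.
by move=> x; apply: continuous_comp; exact: bop_continuous.
Qed.

Definition bop_one := Bop bounded_op_id.
Definition bop_mul (S T : bop) := Bop (bounded_op_comp S T).

Lemma bop_mulA : associative bop_mul.
Proof. by move=> S T U; apply: val_inj. Qed.
Lemma bop_mul1r : left_id bop_one bop_mul.
Proof. by move=> S; apply: val_inj. Qed.
Lemma bop_mulr1 : right_id bop_one bop_mul.
Proof. by move=> S; apply: val_inj. Qed.
Lemma bop_mulDl : left_distributive bop_mul +%R.
Proof. by move=> S T U; apply: val_inj. Qed.
Lemma bop_mulDr : right_distributive bop_mul +%R.
Proof.
move=> S T U; apply: val_inj; apply/funext => x.
by have := bop_linear S 1 (T x) (U x); rewrite !scale1r.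
Qed.

HB.instance Definition _ := GRing.Zmodule_isPzRing.Build bop
  bop_mulA bop_mul1r bop_mulr1 bop_mulDl bop_mulDr.

End BoundedOperators.

Section OperatorNorms.
Context {R : realType}.

Definition opnorm_for (V : Type) (N : V -> R) (T : V -> V) : R :=
  sup [set N (T x) | x in [set x | N x <= 1]].

Definition l2norm (V : Type) (N : V -> R) (n : nat) (x : 'I_n -> V) : R :=
  Num.sqrt (\sum_i N (x i) ^+ 2).

Definition mxact (V : lmodType R[i]) (n : nat) (a : 'I_n -> 'I_n -> V -> V)
  (x : 'I_n -> V) : 'I_n -> V := fun i => \sum_j a i j (x j).

Definition opnorm (H : hilbertType R) (T : bop H) : R :=
  opnorm_for (@rnorm R H) T.

(* The norm of M_n(B(H)) = B(H^n). *)
Definition bop_mxnorm (H : hilbertType R) (n : nat) (a : 'M[bop H]_n) : R :=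
  opnorm_for (l2norm (@rnorm R H) (n := n)) (mxact (fun i j => a i j : H -> H)).

Definition euclnorm (k : nat) (v : 'cV[R[i]]_k) : R :=
  l2norm (@rnorm R R[i]^o) (fun i => v i 0).

(* The norm of M_n(M_k) = B((C^k)^n), C^k being the euclidean space. *)
Definition cmx_mxnorm (k n : nat) (a : 'M['M[R[i]]_k]_n) : R :=
  opnorm_for (l2norm (@euclnorm k) (n := n)) (mxact (fun i j => mulmx (a i j))).

End OperatorNorms.

Section Subalgebras.
Context {R : realType} {H : hilbertType R}.
Implicit Types (B : set (bop H)) (S T : bop H).

Definition subalgebra B : Prop :=
  [/\ B 0, forall (c : R[i]) S T, B S -> B T -> B (c *: S + T) &
      forall S T, B S -> B T -> B (S * T)].

Definition norm_closed B : Prop := forall T,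
  (forall e : R, 0 < e -> exists2 S, B S & opnorm (T - S) < e) -> B T.

Definition operator_algebra B : Prop := subalgebra B /\ norm_closed B.

Definition is_adjoint T S : Prop := forall x y, hdot (T x) y = hdot x (S y).

Definition selfadjoint B : Prop := forall T S, B T -> is_adjoint T S -> B S.

Definition cstar_generated (X : set (bop H)) : set (bop H) :=
  smallest [set B | operator_algebra B /\ selfadjoint B] X.

Definition subspace (V : set H) : Prop :=
  V 0 /\ forall (c : R[i]) x y, V x -> V y -> V (c *: x + y).

Definition closed_span (X : set H) : set H :=
  smallest [set V | subspace V /\ closed V] X.

Definition fin_dim (V : set H) : Prop :=
  exists (n : nat) (e : 'I_n -> H), forall x, V x ->
    exists c : 'I_n -> R[i], x = \sum_i c i *: e i.

End Subalgebras.

Record unitalOpAlg (R : realType) (K : hilbertType R) := UnitalOpAlg {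
  oa_set : set (bop K) ;
  oa_operator_algebra : operator_algebra oa_set ;
  oa_set1 : oa_set 1 }.

Section UnitalOpAlgElements.
Context {R : realType} {K : hilbertType R} (A : unitalOpAlg K).

Definition oa_pred : {pred bop K} := fun T => `[<oa_set A T>].

Lemma oa_pred_submod : GRing.submod_closed oa_pred.
Proof.
have [[A0 Alin _] _] := oa_operator_algebra A.
split=> [|c S T /asboolP AS /asboolP AT]; apply/asboolP => //.
exact: Alin.
Qed.

Lemma oa_pred_mulr : GRing.mulr_closed oa_pred.
Proof.
have [[_ _ AM] _] := oa_operator_algebra A.
split=> [|S T /asboolP AS /asboolP AT]; apply/asboolP; first exact: oa_set1.
exact: AM.
Qed.

HB.instance Definition _ :=
  GRing.isSubmodClosed.Build R[i] (bop K) oa_pred oa_pred_submod.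

Record oa_elt := OAElt { oa_val :> bop K ; oa_valP : oa_val \in oa_pred }.

HB.instance Definition _ := [isSub for oa_val].
HB.instance Definition _ := [Choice of oa_elt by <:].
HB.instance Definition _ := [SubChoice_isSubLmodule of oa_elt by <:].
HB.instance Definition _ := GRing.SubNmodule_isSubPzSemiRing.Build (bop K)
  oa_pred oa_elt oa_pred_mulr.

End UnitalOpAlgElements.

Coercion oa_elt : unitalOpAlg >-> Sortclass.

Section Representations.
Context {R : realType} {K : hilbertType R} (A : unitalOpAlg K).

Definition oa_mxnorm (n : nat) (a : 'M[A]_n) : R :=
  bop_mxnorm (map_mx (@oa_val R K A) a).

Definition representation (H : hilbertType R) (pi : {linear A -> bop H}) : Prop :=
  (forall a b : A, pi (a * b) = pi a * pi b) /\
  (forall (n : nat) (a : 'M[A]_n), bop_mxnorm (map_mx pi a) <= oa_mxnorm a).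

Definition rfd : Prop := forall (n : nat) (a : 'M[A]_n),
  oa_mxnorm a = sup [set r | exists (H : hilbertType R) (pi : {linear A -> bop H}),
    [/\ fin_dim [set: H], representation pi & r = bop_mxnorm (map_mx pi a)]].

Definition fin_dim_representation (H : hilbertType R)
    (pi : {linear A -> bop H}) : Prop :=
  representation pi /\
  fin_dim (closed_span [set (T : bop H) x | T in cstar_generated (range pi)
                                          & x in [set: H]]).

Definition bounded_functional : {pred A -> R[i]^o} := fun f =>
  `[<scalar f /\ exists M : R, forall a : A, rnorm (f a) <= M * opnorm a>].

Record dual := Dual {
  dual_fun :> A -> R[i]^o ; dual_funP : dual_fun \in bounded_functional }.

HB.instance Definition _ := [isSub for dual_fun].
HB.instance Definition _ := [Choice of dual by <:].

(* the weak-* topology on A' *)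
HB.instance Definition _ := Topological.copy dual
  (initial_topology (dual_fun : dual -> {ptws A -> R[i]^o})).

(* An n x n matrix of functionals is identified with a map A -> M_n;
   'M[dual]_n has the product topology of the weak-* topology. *)
Definition mxdual_fun (n : nat) (phi : 'M[dual]_n) (a : A) : 'M[R[i]]_n :=
  \matrix_(i, j) phi i j a.

(* S_n(A) *)
Definition matrix_states (n : nat) : set 'M[dual]_n := [set phi |
  mxdual_fun phi 1 = 1%:M /\
  forall (m : nat) (a : 'M[A]_m),
    cmx_mxnorm (map_mx (mxdual_fun phi) a) <= oa_mxnorm a].

(* ws is the adjoint w^* of the isometry w. *)
Definition fin_dim_matrix_states (n : nat) : set 'M[dual]_n := [set phi |
  matrix_states phi /\
  exists (H : hilbertType R) (w : {linear 'cV[R[i]]_n -> H})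
         (ws : H -> 'cV[R[i]]_n) (pi : {linear A -> bop H}),
    [/\ fin_dim [set: H],
        forall v, rnorm (w v) = euclnorm v,
        forall v x, hdot (w v) x = \sum_i v i 0 * (ws x i 0)^*,
        representation pi /\ pi 1 = 1 &
        forall a v, mxdual_fun phi a *m v = ws (pi a (w v))]].

Definition fin_dim_matrix_states_dense : Prop := forall n : nat, (0 < n)%N ->
  matrix_states (n := n) `<=` closure (fin_dim_matrix_states (n := n)).

End Representations.

Definition wot (R : realType) (H : hilbertType R) : topologicalType :=
  initial_topology ((fun (T : bop H) (xy : H * H) => hdot (T xy.1) xy.2)
                    : bop H -> {ptws H * H -> R[i]^o}).

Definition directed (I : Type) (le : I -> I -> Prop) : Prop :=
  [/\ inhabited I, forall i, le i i,
      forall i j k, le i j -> le j k -> le i k &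
      forall i j, exists k, le i k /\ le j k].

Definition net_filter (I : Type) (le : I -> I -> Prop) : set_system I :=
  filter_from [set: I] (fun i => [set j | le i j]).

Definition wot_approximable (R : realType) (K : hilbertType R)
    (A : unitalOpAlg K) : Prop :=
  forall (H : hilbertType R) (pi : {linear A -> bop H}), representation pi ->
    exists (I : Type) (le : I -> I -> Prop) (pi_ : I -> {linear A -> bop H}),
      [/\ directed le, forall i, fin_dim_representation (pi_ i) &
          forall a : A, (fun i => pi_ i a : wot H) @ net_filter le --> (pi a : wot H)].

(* Main.v *)
Require Import Defs.
From HB Require Import structures.
From mathcomp Require Import all_boot all_order all_algebra.
From mathcomp Require Import all_classical all_reals all_analysis.
From mathcomp Require Import complex.
From mathcomp Require Import ring lra zify.

(** Residual finite dimensionality is shown to imply density of the finite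
    dimensional matrix states, which implies approximability in the weak
    operator topology, which implies residual finite dimensionality.
    Throughout, finite dimensional unital representations are handled as matrix
    representations: unital, multiplicative, completely contractive maps
    [rho : A -> M_N].  An orthonormal family of [N] vectors in a Hilbert space
    [H] carries [rho] to a finite dimensional representation on [H]
    ([mxrep_expand]).  Conversely a representation [pi] lives on the range of
    the projection [pi 1]; if that range is finite dimensional, an orthonormal
    basis of it turns [pi] into a matrix representation without loss of norms
    ([rep_frame]).

    Density ([rfd_dense]).  Fix a matrix state [phi] with values in [M_n] and
    finitely many [a_k] in [A].  The tuples [<rho(a_k) X_j, X_i>], with [rho] a
    matrix representation and [X] any [n] vectors, form a convex cone, because
    direct sums add them.  If the tuple [phi(a_k)_ij] were not in its closure, a
    functional separating them ([complex_cone_approx]) would be an element [B]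
    of [M_n(A)] with [Re rho(B) <= 0] for all [rho], but [Re <phi(B) e, e> > 0]
    for [e = (e_1, .., e_n)].  The condition [Re rho(B) <= 0] gives
    [|| 1 + t rho(B) ||^2 <= 1 + t^2 || B ||^2] for [t > 0]; residual finite
    dimensionality transports this bound to [1 + t B], and complete
    contractivity transports it to [1 + t phi(B)], so that
    [2 t Re <phi(B) e, e> <= n t^2 || B ||^2].  As [t] tends to 0 this is a
    contradiction ([accretive_state]).  With [1] among the [a_k] the vectors [X]
    are almost orthonormal; moving them to an orthonormal family
    ([near_orthonormal]) gives a finite dimensional matrix state close to [phi].

    Approximation ([dense_wot_approximable]).  If [H] is finite dimensional, the
    constant net works.  Otherwise let [e] be an orthonormal basis of the span
    of [pi(1) x], for finitely many vectors [x].  The compression of [pi] to [e]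
    is a matrix state, hence close to the corner of a matrix representation on
    some [C^(n + m)] ([dense_frame]).  Place the first [n] basis vectors on [e]
    and the other [m] in directions orthogonal to all the given [x]: the
    representation so obtained on [H] has almost the same matrix coefficients
    as [pi] at these vectors ([wot_approx_finite]).

    Residual finite dimensionality ([wot_approximable_rfd]).  Approximate the
    inclusion of [A] in [B(K)]: norms are lower semicontinuous for the weak
    operator topology, and by [rep_frame] the approximating representations
    attain their norms on finite dimensional spaces. *)

Set Implicit Arguments.
Unset Strict Implicit.
Unset Printing Implicit Defensive.
Import Order.TTheory GRing.Theory Num.Theory numFieldNormedType.Exports.
Local Open Scope classical_set_scope.
Local Open Scope ring_scope.
Local Open Scope complex_scope.

(** * Moduli of complex numbers and sesquilinear forms *)

(** The norm `|z| is itself an element of [R[i]]. *)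
Definition cabs (R : realType) (z : R[i]) : R := complex.Re `|z|.

Section Modulus.
Context {R : realType}.
Implicit Types z w : R[i].

Lemma cabsE z : (cabs z)%:C = `|z|.
Proof. by rewrite RRe_real ?normr_real. Qed.
Lemma cabs_ge0 z : 0 <= cabs z.
Proof. by rewrite -lecR cabsE normr_ge0. Qed.
Lemma cabsD z w : cabs (z + w) <= cabs z + cabs w.
Proof. by rewrite -lecR rmorphD /= !cabsE ler_normD. Qed.
Lemma cabsM z w : cabs (z * w) = cabs z * cabs w.
Proof. by apply: complexI; rewrite rmorphM /= !cabsE normrM. Qed.
Lemma cabsN z : cabs (- z) = cabs z.
Proof. by rewrite /cabs normrN. Qed.
Lemma cabsB z w : cabs (z - w) = cabs (w - z).
Proof. by rewrite -cabsN opprB. Qed.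
Lemma cabs0 : cabs (0 : R[i]) = 0.
Proof. by rewrite /cabs normr0. Qed.
Lemma cabs0_eq0 z : cabs z = 0 -> z = 0.
Proof. by move=> z0; apply/eqP; rewrite -normr_eq0 -cabsE z0. Qed.
Lemma cabsJ z : cabs (conjc z) = cabs z.
Proof. by rewrite /cabs normcJ. Qed.
Lemma cabsR (r : R) : cabs r%:C = `|r|.
Proof. by rewrite /cabs normc_def /= expr0n addr0 sqrtr_sqr. Qed.
Lemma cabs_sum (I : Type) (s : seq I) (P : pred I) (F : I -> R[i]) :
  cabs (\sum_(i <- s | P i) F i) <= \sum_(i <- s | P i) cabs (F i).
Proof.
elim/big_rec2: _ => [|i x y _ le]; first by rewrite cabs0.
by apply: le_trans (cabsD _ _) _; rewrite lerD2l.
Qed.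
Lemma cabs_sqr z : (cabs z ^+ 2)%:C = z * conjc z.
Proof. by rewrite rmorphXn /= cabsE sqr_normc. Qed.
Lemma cabs_sqrE z : cabs z ^+ 2 = complex.Re z ^+ 2 + complex.Im z ^+ 2.
Proof. by apply: complexI; rewrite add_Re2_Im2 rmorphXn /= cabsE. Qed.
Lemma Re_le_cabs z : complex.Re z <= cabs z.
Proof.
apply: le_trans (ler_norm _) _.
by rewrite -lecR cabsE normc_ge_Re.
Qed.
Lemma ReD z w : complex.Re (z + w) = complex.Re z + complex.Re w.
Proof. by case: z; case: w. Qed.
Lemma ReN z : complex.Re (- z) = - complex.Re z.
Proof. by case: z. Qed.
Lemma ReM (r : R) z : complex.Re (r%:C * z) = r * complex.Re z.
Proof. by case: z => a b /=; rewrite mul0r subr0. Qed.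
Lemma ReJ z : complex.Re (conjc z) = complex.Re z.
Proof. by case: z. Qed.
Lemma Re_sum (I : Type) (s : seq I) (P : pred I) (F : I -> R[i]) :
  complex.Re (\sum_(i <- s | P i) F i) = \sum_(i <- s | P i) complex.Re (F i).
Proof. by elim/big_rec2: _ => [|i x y _ <-] //; rewrite ReD. Qed.
End Modulus.

Lemma conjcZ (R : realType) (r : R) (z : R[i]) : conjc (r%:C * z) = r%:C * conjc z.
Proof. by case: z => a b; rewrite /GRing.mul /=; congr Complex; ring. Qed.

Lemma le0_small (R : realType) (r C : R) : 0 <= C ->
  (forall d, 0 < d -> r <= d * C) -> r <= 0.
Proof.
move=> C0 rC; apply/ler_addgt0Pr => d d0; rewrite add0r.
have C1 : 0 < C + 1 by rewrite ltr_wpDl.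
apply: le_trans (rC (d / (C + 1)) _) _; first by rewrite divr_gt0.
by rewrite mulrAC ler_pdivrMr // ler_wpM2l ?(ltW d0) // lerDl.
Qed.

Section Form.
Context {R : realType} (V : lmodType R[i]) (h : V -> V -> R[i]).
Hypothesis h_linear : forall y, scalar (h^~ y).
Hypothesis h_conj : forall x y, h x y = (h y x)^*.
Hypothesis h_ge0 : forall x, 0 <= h x x.
Hypothesis h_def : forall x, h x x = 0 -> x = 0.

Lemma formDl x y z : h (x + y) z = h x z + h y z.
Proof. by have := h_linear z 1 x y; rewrite scale1r mul1r. Qed.
Lemma form0l z : h 0 z = 0.
Proof. by have := formDl 0 0 z; rewrite addr0 => /esym/eqP;
  rewrite -subr_eq0 addrK => /eqP. Qed.
Lemma formZl c x z : h (c *: x) z = c * h x z.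
Proof. by have := h_linear z c x 0; rewrite !addr0 form0l addr0. Qed.
Lemma formDr x y z : h x (y + z) = h x y + h x z.
Proof. by rewrite h_conj formDl rmorphD /= -!h_conj. Qed.
Lemma formZr c x y : h x (c *: y) = conjc c * h x y.
Proof. by rewrite h_conj formZl rmorphM /= -h_conj. Qed.

(** Nonnegativity of the form at the vector [h y y *: x - h x y *: y]; a
    definite form is needed where [h y y = 0]. *)
Lemma form_CS x y : `|h x y| ^+ 2 <= h x x * h y y.
Proof.
have [y0|y0] := eqVneq (h y y) 0.
  by rewrite y0 mulr0 (h_def y0) h_conj form0l conjc0 normr0 expr0n.
have yp : 0 < h y y by rewrite lt_def y0 h_ge0.
have := h_ge0 (h y y *: x + (- h x y) *: y).
rewrite !(formDl, formDr, formZl, formZr) rmorphN /= -!h_conj.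
set D := h y y; set u := h x y; set v := h y x; set w := h x x.
have -> : D * (D * w) + D * (- v * u) + (- u * (D * v) + - u * (- v * D))
  = D * (w * D - u * v) by ring.
rewrite pmulr_rge0 // subr_ge0 => le.
by rewrite sqr_normc /u /v -h_conj.
Qed.

Variable n : V -> R[i].
Hypothesis n_ge0 : forall x, 0 <= n x.
Hypothesis n_sqr : forall x, n x ^+ 2 = h x x.

Lemma form_normZ c x : n (c *: x) = `|c| * n x.
Proof.
apply/eqP; rewrite -(eqrXn2 (ltn0Sn 1)) ?mulr_ge0 ?n_ge0 //.
by rewrite exprMn !n_sqr formZl formZr sqr_normc mulrA.
Qed.

Lemma form_norm0_eq0 x : n x = 0 -> x = 0.
Proof. by move=> x0; apply: h_def; rewrite -n_sqr x0 expr0n. Qed.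

Lemma form_normD x y : n (x + y) <= n x + n y.
Proof.
rewrite -(@ler_pXn2r _ 2) ?nnegrE ?addr_ge0 ?n_ge0 //.
rewrite sqrrD !n_sqr !(formDl, formDr) [h y x]h_conj.
have -> : h x x + h x y + (conjc (h x y) + h y y)
   = h x x + (h x y + conjc (h x y)) + h y y by ring.
rewrite lerD2r lerD2l.
rewrite addcJ mulr_natl ler_pMn2r //.
apply: (@le_trans _ _ `|h x y|).
  by rewrite -cabsE lecR Re_le_cabs.
rewrite -(@ler_pXn2r _ 2) ?nnegrE ?mulr_ge0 ?n_ge0 //.
by rewrite exprMn !n_sqr form_CS.
Qed.
End Form.

(** * Euclidean spaces as Hilbert spaces *)

Section Euclidean.
Context {R : realType}.

(** An alias of the column vectors, which already carry the sup norm. *)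
Definition eucl (k : nat) := 'cV[R[i]]_k.
HB.instance Definition _ k := GRing.Lmodule.on (eucl k).

Definition edot k (x y : eucl k) : R[i] := \sum_i x i 0 * conjc (y i 0).

Lemma edot_linear k y : scalar (@edot k ^~ y).
Proof.
move=> c x z; rewrite /edot mulr_sumr -big_split /=; apply: eq_bigr => i _.
by rewrite !mxE mulrDl mulrA.
Qed.

Lemma edot_conj k x y : @edot k x y = conjc (edot y x).
Proof.
rewrite /edot rmorph_sum; apply: eq_bigr => i _ /=.
by rewrite rmorphM /= conjcK mulrC.
Qed.

Lemma edotE k x : @edot k x x = (\sum_i cabs (x i 0) ^+ 2)%:C.
Proof. by rewrite /edot rmorph_sum; apply: eq_bigr => i _; rewrite /= cabs_sqr. Qed.

Lemma edot_ge0 k x : 0 <= @edot k x x.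
Proof. by rewrite edotE ler0c sumr_ge0 // => i _; rewrite sqr_ge0. Qed.

Lemma edot_def k x : @edot k x x = 0 -> x = 0.
Proof.
rewrite edotE => /complexI/eqP; rewrite psumr_eq0 => [/allP x0|i _]; last exact: sqr_ge0.
apply/colP => i; rewrite mxE; apply: cabs0_eq0.
by have := x0 i (mem_index_enum _); rewrite /= sqrf_eq0 => /eqP.
Qed.

Definition enorm k (x : eucl k) : R[i] := (Num.sqrt (\sum_i cabs (x i 0) ^+ 2))%:C.

Lemma enorm_sqr k x : @enorm k x ^+ 2 = edot x x.
Proof.
by rewrite edotE -rmorphXn /= sqr_sqrtr // sumr_ge0 // => i _; rewrite sqr_ge0.
Qed.

Lemma enorm_ge0 k x : 0 <= @enorm k x.
Proof. by rewrite ler0c sqrtr_ge0. Qed.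

HB.instance Definition _ k := Lmodule_isNormed.Build R[i] (eucl k)
  (form_normD (@edot_linear k) (@edot_conj k) (@edot_ge0 k) (@edot_def k)
     (@enorm_ge0 k) (@enorm_sqr k))
  (form_normZ (@edot_linear k) (@edot_conj k) (@enorm_ge0 k) (@enorm_sqr k))
  (form_norm0_eq0 (@edot_def k) (@enorm_sqr k)).

Lemma cabs_coord k (x : eucl k) i : cabs (x i 0) <= complex.Re `|x|.
Proof.
rewrite -(@ler_pXn2r _ 2) ?nnegrE ?cabs_ge0 //; last by rewrite sqrtr_ge0.
rewrite sqr_sqrtr; last by rewrite sumr_ge0 // => j _; rewrite sqr_ge0.
by rewrite (bigD1 i) //= lerDl sumr_ge0 // => j _; rewrite sqr_ge0.
Qed.

(** The real and imaginary parts of the coordinates are 1-Lipschitz, so a Cauchy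
    filter converges in each of them. *)
Lemma eucl_complete k (F : set_system (eucl k)) :
  ProperFilter F -> cauchy F -> cvg F.
Proof.
move=> FF /cauchyP Fc.
have coord (f : R[i] -> R) : (forall z w, `|f z - f w| <= cabs (z - w)) ->
    exists l : 'I_k -> R, forall i (e : R), 0 < e ->
      F [set x | `|l i - f ((x : 'cV[R[i]]_k) i 0)| < e].
  move=> flip.
  suff /choice[l Hl] : forall i, exists l, forall e : R, 0 < e ->
      F [set x | `|l - f ((x : 'cV[R[i]]_k) i 0)| < e] by exists l.
  move=> i; have /cvg_ex[l Hl] : cvg ((fun x : eucl k => f (x i 0)) @ F).
    apply: R_complete; apply/cauchyP => e e0.
    have [|x Fx] := Fc e%:C; first by rewrite ltcR.
    exists (f (x i 0)); rewrite /fmap /=; apply: filterS Fx => y.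
    rewrite -!ball_normE /= => /[!ltcE]/andP[_ xy].
    apply: le_lt_trans (flip _ _) _.
    have := cabs_coord (x - y) i; rewrite !mxE => /le_lt_trans; exact.
  by exists l => e e0; move/cvgrPdist_lt: Hl => /(_ _ e0).
have [|a Ha] := coord (@complex.Re R).
  move=> z w; rewrite -(@ler_pXn2r _ 2) ?nnegrE ?cabs_ge0 //.
  by rewrite real_normK ?num_real // cabs_sqrE ReD ReN lerDl sqr_ge0.
have [|b Hb] := coord (@complex.Im R).
  move=> [z1 z2] [w1 w2]; rewrite -(@ler_pXn2r _ 2) ?nnegrE ?cabs_ge0 //.
  by rewrite real_normK ?num_real // cabs_sqrE /= lerDr sqr_ge0.
apply/cvg_ex; exists (\col_i (a i +i* b i) : eucl k).
apply/cvgrPdist_le => e e0.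
have er : e = (complex.Re e)%:C by rewrite RRe_real ?gtr0_real.
move: e0; rewrite {}er ltcR; move: (complex.Re e) => r r0.
(* If both parts of all [k] coordinates are within [d], the squared distance is
   at most [2 k d^2], and this is less than [r^2]. *)
pose d := r / k.+1%:R / 2.
have d0 : 0 < d by rewrite !divr_gt0.
have near1 i : F ([set x | `|a i - complex.Re ((x : 'cV[R[i]]_k) i 0)| < d]
    `&` [set x | `|b i - complex.Im ((x : 'cV[R[i]]_k) i 0)| < d]).
  by apply: filterI; [exact: Ha|exact: Hb].
move/filter_forall: near1 => near1.
apply: filterS near1 => x Hx.
rewrite lecR -(@ler_pXn2r _ 2) ?nnegrE ?sqrtr_ge0 ?(ltW r0) //.
rewrite sqr_sqrtr; last by rewrite sumr_ge0 // => j _; rewrite sqr_ge0.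
apply: (@le_trans _ _ (\sum_(i < k) 2 * d ^+ 2)).
  apply: ler_sum => i _; have [/= /ltW Hre /ltW Him] := Hx i.
  rewrite !mxE cabs_sqrE mulr_natl mulr2n !ReD ReN /=.
  have -> : complex.Im (a i +i* b i - x i 0) = b i - complex.Im (x i 0).
    by case: (x i 0).
  rewrite -[leLHS]/(_ + _) -[X in X + _]real_normK ?num_real //.
  rewrite -[X in _ + X]real_normK ?num_real //.
  by rewrite lerD // ler_pXn2r // ?nnegrE ?(ltW d0).
rewrite sumr_const card_ord -[leLHS]mulr_natl.
have rE : r = 2 * k.+1%:R * d.
  by rewrite /d; field; rewrite nat1r pnatr_eq0.
clearbody d; rewrite rE -[k.+1%:R]natr1; have : 0 <= k%:R :> R by [].
move: k%:R => K K0; rewrite exprMn [leLHS]mulrA ler_wpM2r ?sqr_ge0 //; nra.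
Qed.

HB.instance Definition _ k := Uniform_isComplete.Build (eucl k) (@eucl_complete k).

Lemma edot_norm k (x : eucl k) : edot x x = `|x| ^+ 2.
Proof. by rewrite -enorm_sqr. Qed.

HB.instance Definition _ k := isHilbert.Build R (eucl k)
  (@edot_linear k) (@edot_conj k) (@edot_norm k).

End Euclidean.

(** * Inner products and operator norms *)

Section HilbertBasics.
Context {R : realType} {H : hilbertType R}.
Implicit Types x y z : H.

Lemma rnormE x : (rnorm x)%:C = `|x|.
Proof. by rewrite RRe_real ?normr_real. Qed.
Lemma rnorm_ge0 x : 0 <= rnorm x.
Proof. by rewrite -lecR rnormE normr_ge0. Qed.
Lemma rnormD x y : rnorm (x + y) <= rnorm x + rnorm y.
Proof. by rewrite -lecR rmorphD /= !rnormE ler_normD. Qed.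
Lemma rnormZ (c : R[i]) x : rnorm (c *: x) = cabs c * rnorm x.
Proof. by apply: complexI; rewrite rmorphM /= !rnormE cabsE normrZ. Qed.
Lemma rnormN x : rnorm (- x) = rnorm x.
Proof. by rewrite /rnorm normrN. Qed.
Lemma rnormB x y : rnorm (x - y) = rnorm (y - x).
Proof. by rewrite -rnormN opprB. Qed.
Lemma rnorm0 : rnorm (0 : H) = 0.
Proof. by rewrite /rnorm normr0. Qed.
Lemma rnorm0_eq0 x : rnorm x = 0 -> x = 0.
Proof. by move=> x0; apply/eqP; rewrite -normr_eq0 -rnormE x0. Qed.
Lemma rnorm_sum (I : Type) (s : seq I) (P : pred I) (F : I -> H) :
  rnorm (\sum_(i <- s | P i) F i) <= \sum_(i <- s | P i) rnorm (F i).
Proof.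
elim/big_rec2: _ => [|i x y _ le]; first by rewrite rnorm0.
by apply: le_trans (rnormD _ _) _; rewrite lerD2l.
Qed.

Lemma hdotDl x y z : hdot (x + y) z = hdot x z + hdot y z.
Proof. exact: (formDl (@hdot_linearl R H)). Qed.
Lemma hdot0l z : hdot 0 z = 0.
Proof. exact: (form0l (@hdot_linearl R H)). Qed.
Lemma hdotZl c x z : hdot (c *: x) z = c * hdot x z.
Proof. exact: (formZl (@hdot_linearl R H)). Qed.
Lemma hdotDr x y z : hdot x (y + z) = hdot x y + hdot x z.
Proof. exact: (formDr (@hdot_linearl R H) (@hdot_conj R H)). Qed.
Lemma hdotZr c x y : hdot x (c *: y) = conjc c * hdot x y.
Proof. exact: (formZr (@hdot_linearl R H) (@hdot_conj R H)). Qed.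
Lemma hdotNl x y : hdot (- x) y = - hdot x y.
Proof. by rewrite -scaleN1r hdotZl mulN1r. Qed.
Lemma hdotNr x y : hdot x (- y) = - hdot x y.
Proof. by rewrite hdot_conj hdotNl rmorphN /= -hdot_conj. Qed.
Lemma hdotBl x y z : hdot (x - y) z = hdot x z - hdot y z.
Proof. by rewrite hdotDl hdotNl. Qed.
Lemma hdotBr x y z : hdot x (y - z) = hdot x y - hdot x z.
Proof. by rewrite hdotDr hdotNr. Qed.
Lemma hdot_suml (I : Type) (s : seq I) (P : pred I) (F : I -> H) y :
  hdot (\sum_(i <- s | P i) F i) y = \sum_(i <- s | P i) hdot (F i) y.
Proof. by elim/big_rec2: _ => [|i a b _ <-]; rewrite (hdot0l, hdotDl). Qed.
Lemma hdotE x : hdot x x = (rnorm x ^+ 2)%:C.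
Proof. by rewrite rmorphXn /= rnormE hdot_norm. Qed.

Lemma rnorm_sqr x : rnorm x ^+ 2 = complex.Re (hdot x x).
Proof. by rewrite hdotE. Qed.

Lemma hdot_eq0 x : hdot x x = 0 -> x = 0.
Proof.
rewrite hdotE => /complexI/eqP; rewrite sqrf_eq0 => /eqP; exact: rnorm0_eq0.
Qed.

Lemma hdot_ext x y : (forall z, hdot x z = hdot y z) -> x = y.
Proof.
move=> e; apply/eqP; rewrite -subr_eq0; apply/eqP/hdot_eq0.
by rewrite hdotBl e subrr.
Qed.

Lemma hdot_CS x y : cabs (hdot x y) <= rnorm x * rnorm y.
Proof.
rewrite -(@ler_pXn2r _ 2) ?nnegrE ?mulr_ge0 ?cabs_ge0 ?rnorm_ge0 //.
rewrite -lecR exprMn [leRHS]rmorphM /= -!hdotE rmorphXn /= cabsE.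
apply: (form_CS (@hdot_linearl R H) (@hdot_conj R H)); last exact: hdot_eq0.
by move=> z; rewrite hdotE ler0c sqr_ge0.
Qed.

Lemma rnorm_sqrD x y : rnorm (x + y) ^+ 2 =
  rnorm x ^+ 2 + complex.Re (hdot x y) *+ 2 + rnorm y ^+ 2.
Proof.
rewrite !rnorm_sqr hdotDl !hdotDr [hdot y x]hdot_conj !ReD ReJ mulr2n.
by rewrite !addrA.
Qed.
End HilbertBasics.

Section Opnorm.
Context {R : realType}.

(** A supremum of an unbounded set of reals is 0, so boundedness has to be known
    before [opnorm_for] bounds anything.  The scaling [sc] is a parameter so that
    vectors and tuples of vectors are covered together. *)
Lemma opnorm_for_ub (V : Type) (N : V -> R) (T : V -> V) (sc : R -> V -> V) :
  (forall x, 0 <= N x) -> (forall r x, 0 <= r -> N (sc r x) = r * N x) ->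
  (forall r x, 0 <= r -> N (T (sc r x)) = r * N (T x)) ->
  (exists M, forall x, N (T x) <= M * N x) ->
  forall x, N (T x) <= opnorm_for N T * N x.
Proof.
move=> N0 Nsc NTsc [M NM] x.
have [x0|x0] := eqVneq (N x) 0.
  by have := NM x; rewrite x0 !mulr0.
have xp : 0 < N x by rewrite lt_def x0 N0.
rewrite -ler_pdivrMr // mulrC -NTsc ?invr_ge0 ?(ltW xp) //.
rewrite /opnorm_for; apply: ub_le_sup; last first.
  by exists (sc (N x)^-1 x) => //=; rewrite Nsc ?mulVf ?invr_ge0 ?(ltW xp).
exists (Num.max M 0) => _ [y /= y1 <-]; apply: le_trans (NM y) _.
have [M0|M0] := leP 0 M.
  by apply: le_trans (ler_wpM2l M0 y1) _; rewrite mulr1.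
by rewrite nmulr_rle0 // N0.
Qed.

Lemma opnorm_for_le (V : Type) (N : V -> R) (T : V -> V) (x0 : V) (C : R) :
  N x0 <= 1 -> 0 <= C -> (forall x, N (T x) <= C * N x) -> opnorm_for N T <= C.
Proof.
move=> Nx0 C0 le; rewrite /opnorm_for; apply: ge_sup; first by exists (N (T x0)), x0.
move=> _ [y /= y1 <-]; apply: le_trans (le y) _.
by apply: le_trans (ler_wpM2l C0 y1) _; rewrite mulr1.
Qed.

Lemma opnorm_for_ge0 (V : Type) (N : V -> R) (T : V -> V) :
  (forall x, 0 <= N x) -> 0 <= opnorm_for N T.
Proof.
move=> N0; rewrite /opnorm_for.
have [->|/set0P[r [x x1 xr]]] := eqVneq [set N (T x) | x in [set x | N x <= 1]] set0.
  by rewrite sup0.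
have [hs|hs] := pselect (has_sup [set N (T x) | x in [set x | N x <= 1]]); last first.
  by rewrite sup_out.
apply: le_trans (ub_le_sup _ _); [|by case: hs|by exists x].
exact: N0.
Qed.

Context {H : hilbertType R}.

Lemma bop_bounded (T : bop H) : exists2 M : R, 0 <= M & forall x, rnorm (T x) <=
  M * rnorm x.
Proof.
pose f : {linear H -> H} := HB.pack (T : H -> H)
  (GRing.isLinear.Build _ _ _ _ _ (bop_linear T)).
have /linear_boundedP fb : bounded_near f (nbhs (0 : H)).
  by apply/linear_bounded_continuous; exact: bop_continuous.
have [M M0 fM] := pinfty_ex_gt0 fb.
have ME : M = (complex.Re M)%:C by rewrite RRe_real ?gtr0_real.
exists (complex.Re M); first by rewrite ltW // -ltcR -ME.
by move=> x; rewrite -lecR rmorphM /= !rnormE -ME; exact: fM.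
Qed.

Lemma opnorm_ub (T : bop H) x : rnorm (T x) <= opnorm T * rnorm x.
Proof.
apply: (opnorm_for_ub (sc := fun (r : R) (x : H) => r%:C *: x)).
- exact: rnorm_ge0.
- by move=> r y r0; rewrite rnormZ cabsR ger0_norm.
- move=> r y r0; have := bop_linear T r%:C y 0; rewrite addr0 => ->.
  have -> : T 0 = 0.
    by have := bop_linear T 1 0 0; rewrite scale1r addr0 scale1r => /esym/eqP;
      rewrite -subr_eq0 addrK => /eqP.
  by rewrite addr0 rnormZ cabsR ger0_norm.
- by have [M _ TM] := bop_bounded T; exists M.
Qed.
End Opnorm.

(** * Norms of matrices of operators *)

Section MatrixNorms.
Context {R : realType}.

Lemma sum_sqr_ge0 (I : finType) (F : I -> R) : 0 <= \sum_i F i ^+ 2.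
Proof. by rewrite sumr_ge0 // => i _; rewrite sqr_ge0. Qed.

Lemma l2norm_sqr (V : Type) (N : V -> R) n (x : 'I_n -> V) :
  l2norm N x ^+ 2 = \sum_i N (x i) ^+ 2.
Proof. by rewrite sqr_sqrtr // sum_sqr_ge0. Qed.

Lemma l2norm_ge0 (V : Type) (N : V -> R) n (x : 'I_n -> V) : 0 <= l2norm N x.
Proof. exact: sqrtr_ge0. Qed.

Lemma l2norm_leE (V : Type) (N : V -> R) n (x y : 'I_n -> V) (C : R) : 0 <= C ->
  (l2norm N y <= C * l2norm N x) =
  (\sum_i N (y i) ^+ 2 <= C ^+ 2 * \sum_i N (x i) ^+ 2).
Proof.
move=> C0; rewrite -(@ler_pXn2r _ 2) ?nnegrE ?mulr_ge0 ?l2norm_ge0 //.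
by rewrite exprMn !l2norm_sqr.
Qed.

Lemma ler_l2norm (V : Type) (N : V -> R) n (x : 'I_n -> V) j :
  0 <= N (x j) -> N (x j) <= l2norm N x.
Proof.
move=> xj0; rewrite -(@ler_pXn2r _ 2) ?nnegrE ?l2norm_ge0 // l2norm_sqr.
by rewrite (bigD1 j) //= lerDl sumr_ge0 // => i _; rewrite sqr_ge0.
Qed.

Lemma l2norm_le_sum (V : Type) (N : V -> R) n (x : 'I_n -> V) :
  (forall v, 0 <= N v) -> l2norm N x <= \sum_i N (x i).
Proof.
move=> N0; have S0 : 0 <= \sum_i N (x i) by rewrite sumr_ge0.
rewrite -(@ler_pXn2r _ 2) ?nnegrE ?l2norm_ge0 // l2norm_sqr expr2 mulr_suml.
apply: ler_sum => i _; rewrite expr2 ler_wpM2l ?N0 //.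
by rewrite (bigD1 i) //= lerDl sumr_ge0.
Qed.

Lemma l2normZ (V : Type) (N : V -> R) n (x y : 'I_n -> V) (r : R) : 0 <= r ->
  (forall i, N (y i) = r * N (x i)) -> l2norm N y = r * l2norm N x.
Proof.
move=> r0 yE; rewrite /l2norm.
under eq_bigr do rewrite yE exprMn.
by rewrite -mulr_sumr sqrtrM ?sqr_ge0 // sqrtr_sqr ger0_norm.
Qed.

Section Maps.
Context {H : hilbertType R} (n : nat) (a : 'I_n -> 'I_n -> H -> H).
Hypothesis a_linear : forall i j, linear (a i j).
Hypothesis a_bounded : forall i j, exists M : R, forall x, rnorm (a i j x) <= M * rnorm x.

(** Bounded entries make a bounded block map, by comparison of the l2 norm with
    the l1 norm. *)
Lemma mxact_ub x : \sum_i rnorm (mxact a x i) ^+ 2 <=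
  opnorm_for (l2norm (@rnorm R H) (n := n)) (mxact a) ^+ 2 * \sum_i rnorm (x i) ^+ 2.
Proof.
rewrite -l2norm_leE; last exact/opnorm_for_ge0/l2norm_ge0.
move: x; apply: (opnorm_for_ub (sc := fun (r : R) (x : 'I_n -> H) i => r%:C *: x i)).
- exact: l2norm_ge0.
- by move=> r x r0; apply: l2normZ => // i; rewrite rnormZ cabsR ger0_norm.
- move=> r x r0; apply: l2normZ => // i.
  rewrite /mxact -[r in RHS]ger0_norm // -cabsR -rnormZ scaler_sumr.
  congr rnorm; apply: eq_bigr => j _.
  have := a_linear i j r%:C (x j) 0; rewrite !addr0 => ->.
  have -> : a i j 0 = 0.
    by have := a_linear i j 1 0 0; rewrite scale1r addr0 scale1r => /esym/eqP;
      rewrite -subr_eq0 addrK => /eqP.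
  by rewrite addr0.
- have /choice[C HC] : forall i, exists M : 'I_n -> R, forall j x, rnorm (a i j x) <=
    M j * rnorm x.
    by move=> i; have /choice[f fP] := a_bounded i; exists f.
  exists (\sum_i \sum_j Num.max 0 (C i j)) => x.
  apply: le_trans (l2norm_le_sum _ (@rnorm_ge0 R H)) _.
  rewrite mulr_suml; apply: ler_sum => i _; rewrite /mxact.
  apply: le_trans (rnorm_sum _ _ _) _; rewrite mulr_suml; apply: ler_sum => j _.
  apply: le_trans (HC _ _ _) _.
  apply: (@le_trans _ _ (Num.max 0 (C i j) * rnorm (x j))).
    by rewrite ler_wpM2r ?rnorm_ge0 // le_max lexx orbT.
  by rewrite ler_wpM2l ?ler_l2norm ?rnorm_ge0 // le_max lexx.
Qed.

Lemma mxact_le (C : R) : 0 <= C ->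
  (forall x, \sum_i rnorm (mxact a x i) ^+ 2 <= C ^+ 2 * \sum_i rnorm (x i) ^+ 2) ->
  opnorm_for (l2norm (@rnorm R H) (n := n)) (mxact a) <= C.
Proof.
move=> C0 le; apply: (@opnorm_for_le _ _ _ _ (fun=> 0)) => //.
  rewrite /l2norm big1 ?sqrtr0 // => i _; by rewrite rnorm0 expr0n.
by move=> x; rewrite l2norm_leE.
Qed.
End Maps.

Section Bop.
Context {H : hilbertType R}.
Implicit Types T : bop H.

Lemma bopD T x y : T (x + y) = T x + T y.
Proof. by have := bop_linear T 1 x y; rewrite !scale1r. Qed.
Lemma bop0 T : T 0 = 0.
Proof. by apply: (addrI (T 0)); rewrite addr0 -bopD addr0. Qed.
Lemma bopZ T c x : T (c *: x) = c *: T x.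
Proof. by have := bop_linear T c x 0; rewrite bop0 !addr0. Qed.
Lemma bop_sum T (I : Type) (s : seq I) (P : pred I) (F : I -> H) :
  T (\sum_(i <- s | P i) F i) = \sum_(i <- s | P i) T (F i).
Proof. by elim/big_rec2: _ => [|i x y _ <-]; rewrite (bop0, bopD). Qed.

Lemma bop_mxnorm_ub n (a : 'M[bop H]_n) (x : 'I_n -> H) :
  \sum_i rnorm (\sum_j a i j (x j)) ^+ 2 <= bop_mxnorm a ^+ 2 * \sum_i rnorm (x i) ^+ 2.
Proof.
apply: (@mxact_ub H n (fun i j => a i j)) => i j; first exact: bop_linear.
by have [M _ aM] := bop_bounded (a i j); exists M.
Qed.

Lemma bop_mxnorm_le n (a : 'M[bop H]_n) (C : R) : 0 <= C ->
  (forall x : 'I_n -> H,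
    \sum_i rnorm (\sum_j a i j (x j)) ^+ 2 <= C ^+ 2 * \sum_i rnorm (x i) ^+ 2) ->
  bop_mxnorm a <= C.
Proof. exact: mxact_le. Qed.

Lemma bop_mxnorm_ge0 n (a : 'M[bop H]_n) : 0 <= bop_mxnorm a.
Proof. exact/opnorm_for_ge0/l2norm_ge0. Qed.

Lemma opnorm_ge0 T : 0 <= opnorm T.
Proof. exact/opnorm_for_ge0/rnorm_ge0. Qed.

Lemma bounded_opP (f : H -> H) : linear f ->
  (exists M : R, forall x, rnorm (f x) <= M * rnorm x) -> f \in @bounded_op R H.
Proof.
move=> fl [M fM]; apply/asboolP; split=> //.
pose g : {linear H -> H} := HB.pack f (GRing.isLinear.Build _ _ _ _ _ fl).
apply: (@bounded_linear_continuous _ _ _ g).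
apply/linear_boundedP; near=> r => x.
apply: (@le_trans _ _ (M%:C * `|x|)).
  by rewrite -!rnormE -rmorphM lecR; exact: fM.
rewrite ler_wpM2r //; near: r; apply: nbhs_pinfty_ge.
by rewrite complex_real.
Unshelve. all: by end_near. Qed.
End Bop.

Section CMatrix.
Context {k : nat}.

Lemma rnorm_eucl (v : eucl k) : rnorm v = euclnorm (v : 'cV[R[i]]_k).
Proof. by []. Qed.

Lemma euclnorm_sqr (v : 'cV[R[i]]_k) : euclnorm v ^+ 2 = \sum_i cabs (v i 0) ^+ 2.
Proof. exact: l2norm_sqr. Qed.

Lemma mulmx_bounded (M : 'M[R[i]]_k) :
  exists C : R, forall v : eucl k, rnorm (M *m v : eucl k) <= C * rnorm v.
Proof.
exists (\sum_j rnorm (col j M : eucl k)) => v.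
have -> : M *m v = \sum_j v j 0 *: (col j M : eucl k).
  by apply/colP => i; rewrite !mxE summxE; apply: eq_bigr => j _; rewrite !mxE mulrC.
apply: le_trans (rnorm_sum _ _ _) _; rewrite mulr_suml; apply: ler_sum => j _.
by rewrite rnormZ mulrC ler_wpM2l ?rnorm_ge0 ?cabs_coord.
Qed.

Lemma cmx_mxnorm_ub n (a : 'M['M[R[i]]_k]_n) (x : 'I_n -> 'cV[R[i]]_k) :
  \sum_i euclnorm (\sum_j a i j *m x j) ^+ 2 <=
  cmx_mxnorm a ^+ 2 * \sum_i euclnorm (x i) ^+ 2.
Proof.
apply: (@mxact_ub (eucl k) n (fun i j => mulmx (a i j))) => i j.
  by move=> c u v; rewrite mulmxDr -scalemxAr.
exact: mulmx_bounded.
Qed.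

Lemma cmx_mxnorm_le n (a : 'M['M[R[i]]_k]_n) (C : R) : 0 <= C ->
  (forall x : 'I_n -> 'cV[R[i]]_k, \sum_i euclnorm (\sum_j a i j *m x j) ^+ 2 <=
     C ^+ 2 * \sum_i euclnorm (x i) ^+ 2) ->
  cmx_mxnorm a <= C.
Proof. exact: (@mxact_le (eucl k) n (fun i j => mulmx (a i j))). Qed.

Lemma cmx_mxnorm_ge0 n (a : 'M['M[R[i]]_k]_n) : 0 <= cmx_mxnorm a.
Proof. exact/opnorm_for_ge0/l2norm_ge0. Qed.
End CMatrix.

End MatrixNorms.

Lemma sum_CS (R : realType) (V : Type) (N : V -> R) n (x y : 'I_n -> V) :
  \sum_i N (x i) * N (y i) <= l2norm N x * l2norm N y.
Proof.
pose v (z : 'I_n -> V) : eucl n := \col_i (N (z i))%:C.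
have vE z : rnorm (v z) = l2norm N z.
  by congr Num.sqrt; apply: eq_bigr => i _; rewrite mxE cabsR real_normK ?num_real.
rewrite -!vE; apply: le_trans (hdot_CS _ _); apply: le_trans (Re_le_cabs _).
rewrite Re_sum le_eqVlt; apply/orP; left; apply/eqP; apply: eq_bigr => i _.
by rewrite !mxE ReM.
Qed.

(** * Coordinates in a finite family of vectors *)

Section Frames.
Context {R : realType} {H : hilbertType R} (N : nat) (e : 'I_N -> H).
Implicit Types (x y : H) (c : 'cV[R[i]]_N) (M : 'M[R[i]]_N) (T S : bop H).

(** For an orthonormal family [e], let V be the isometry of C^N into H that sends
    the standard basis to [e].  Then [coords] is the adjoint of V, [uncoords] is
    V, [compress T] is V^* T V, and [expand M] is V M V^*. *)
Definition coords x : 'cV[R[i]]_N := \col_i hdot x (e i).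
Definition uncoords c : H := \sum_i c i 0 *: e i.
Definition compress T : 'M[R[i]]_N := \matrix_(i, j) hdot (T (e j)) (e i).

Lemma coords_linear : linear coords.
Proof. by move=> c x y; apply/colP => i; rewrite !mxE hdotDl hdotZl. Qed.
HB.instance Definition _ := GRing.isLinear.Build _ _ _ _ coords coords_linear.

Lemma uncoords_linear : linear uncoords.
Proof.
move=> c x y; rewrite /uncoords scaler_sumr -big_split; apply: eq_bigr => i _ /=.
by rewrite !mxE scalerDl scalerA.
Qed.
HB.instance Definition _ := GRing.isLinear.Build _ _ _ _ uncoords uncoords_linear.

Lemma compress_linear : linear compress.
Proof.
by move=> c S T; apply/matrixP => i j; rewrite !mxE /= hdotDl hdotZl.
Qed.
HB.instance Definition _ := GRing.isLinear.Build _ _ _ _ compress compress_linear.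

Lemma compress_mul T c : compress T *m c = coords (T (uncoords c)).
Proof.
apply/colP => i; rewrite !mxE /uncoords bop_sum hdot_suml; apply: eq_bigr => j _.
by rewrite !mxE bopZ hdotZl mulrC.
Qed.

Lemma hdot_uncoords c x : hdot (uncoords c) x = edot c (coords x).
Proof.
rewrite /uncoords hdot_suml; apply: eq_bigr => i _.
by rewrite hdotZl mxE -hdot_conj.
Qed.

Lemma hdot_uncoordsr c x : hdot x (uncoords c) = edot (coords x) c.
Proof. by rewrite hdot_conj hdot_uncoords -edot_conj. Qed.

Lemma uncoords_bounded c : rnorm (uncoords c) <= (\sum_i rnorm (e i)) * euclnorm c.
Proof.
apply: le_trans (rnorm_sum _ _ _) _; rewrite mulr_suml; apply: ler_sum => i _.
by rewrite rnormZ mulrC ler_wpM2l ?rnorm_ge0 // -rnorm_eucl cabs_coord.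
Qed.

Lemma coords_bounded x : euclnorm (coords x) <= (\sum_i rnorm (e i)) * rnorm x.
Proof.
apply: le_trans (l2norm_le_sum _ _) _; first by move=> z; exact: cabs_ge0.
rewrite mulr_suml; apply: ler_sum => i _.
by rewrite mxE mulrC; exact: hdot_CS.
Qed.

Definition expand_fun M x : H := uncoords (M *m coords x).

Lemma expand_subproof M : expand_fun M \in @bounded_op R H.
Proof.
apply: bounded_opP.
  by move=> c x y; rewrite /expand_fun !linearP.
have [C MC] := mulmx_bounded M.
exists ((\sum_i rnorm (e i)) * (Num.max 0 C * (\sum_i rnorm (e i)))) => x.
apply: le_trans (uncoords_bounded _) _.
rewrite -mulrA ler_wpM2l ?sumr_ge0 // => [i _|]; first exact: rnorm_ge0.
apply: le_trans (MC (coords x)) _.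
apply: (@le_trans _ _ (Num.max 0 C * euclnorm (coords x))).
  by rewrite ler_wpM2r ?l2norm_ge0 // le_max lexx orbT.
by rewrite -mulrA ler_wpM2l ?coords_bounded // le_max lexx.
Qed.

Definition expand M : bop H := Bop (expand_subproof M).

Lemma expandE M x : expand M x = uncoords (M *m coords x).
Proof. by []. Qed.

Lemma expand_linear : linear expand.
Proof.
move=> c M M'; apply: val_inj; apply/funext => x /=.
by rewrite /expand_fun mulmxDl -scalemxAl linearP.
Qed.
HB.instance Definition _ := GRing.isLinear.Build _ _ _ _ expand expand_linear.

Definition orthonormal := forall i j, hdot (e i) (e j) = (i == j)%:R.

Hypothesis e_on : orthonormal.

Lemma uncoordsK : cancel uncoords coords.
Proof.
move=> c; apply/colP => i; rewrite mxE hdot_suml (bigD1 i) //= big1.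
  by rewrite addr0 hdotZl e_on eqxx mulr1.
by move=> j ji; rewrite hdotZl e_on (negPf ji) mulr0.
Qed.

Lemma rnorm_orthonormal i : rnorm (e i) = 1.
Proof.
apply/eqP; rewrite -sqrp_eq1 ?rnorm_ge0 // rnorm_sqr e_on eqxx.
by [].
Qed.

Lemma rnorm_uncoords c : rnorm (uncoords c) = euclnorm c.
Proof.
apply/eqP; rewrite -(@eqrXn2 _ 2) ?rnorm_ge0 ?l2norm_ge0 //; apply/eqP.
by apply: complexI; rewrite -hdotE hdot_uncoords uncoordsK edotE euclnorm_sqr.
Qed.

(** The square norm of [uncoords (coords x) - x] is the difference of the two
    square norms. *)
Lemma bessel x : euclnorm (coords x) <= rnorm x.
Proof.
rewrite -(@ler_pXn2r _ 2) ?nnegrE ?rnorm_ge0 ?l2norm_ge0 //.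
have := sqr_ge0 (rnorm (uncoords (coords x) - x)).
rewrite -lecR /= -hdotE hdotBl !hdotBr !hdot_uncoords hdot_uncoordsr uncoordsK subrr
  sub0r opprB.
rewrite hdotE edotE -rmorphB ler0c subr_ge0 euclnorm_sqr.
exact.
Qed.

Lemma compress_expand M : compress (expand M) = M.
Proof.
apply/matrixP => i j; rewrite mxE expandE.
have -> : coords (e j) = delta_mx j 0.
  by apply/colP => l; rewrite !mxE e_on eqxx andbT eq_sym.
by have := congr1 (fun c : 'cV_N => c i 0) (uncoordsK (col j M)); rewrite -colE !mxE.
Qed.

Lemma expandM M M' : expand (M *m M') = expand M * expand M'.
Proof.
apply: val_inj; apply/funext => x /=.
by rewrite /expand_fun /= uncoordsK mulmxA.
Qed.

(** V acts entrywise on tuples as an isometry, and its adjoint as a contraction;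
    hence passing between T and its compression does not increase norms, at any
    matrix level. *)
Lemma bop_mxnorm_expand n (a : 'M['M[R[i]]_N]_n) :
  bop_mxnorm (map_mx expand a) <= cmx_mxnorm a.
Proof.
apply: bop_mxnorm_le; first exact: cmx_mxnorm_ge0.
move=> x; have := cmx_mxnorm_ub a (fun j => coords (x j)).
move=> le;
  apply: (@le_trans _ _ (cmx_mxnorm a ^+ 2 * \sum_i euclnorm (coords (x i)) ^+ 2));
  last first.
  rewrite ler_wpM2l ?sqr_ge0 // ler_sum // => i _.
  by rewrite ler_pXn2r ?nnegrE ?rnorm_ge0 ?l2norm_ge0 ?bessel.
apply: le_trans le; apply: ler_sum => i _.
rewrite -rnorm_uncoords linear_sum.
by under eq_bigr do rewrite mxE.
Qed.

Lemma cmx_mxnorm_compress n (a : 'M[bop H]_n) :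
  cmx_mxnorm (map_mx compress a) <= bop_mxnorm a.
Proof.
apply: cmx_mxnorm_le; first exact: bop_mxnorm_ge0.
move=> x; have := bop_mxnorm_ub a (fun j => uncoords (x j)).
under [X in _ <= _ * X -> _]eq_bigr do rewrite rnorm_uncoords.
move/(le_trans _); apply; apply: ler_sum => i _.
under eq_bigr do rewrite mxE compress_mul.
by rewrite -linear_sum ler_pXn2r ?nnegrE ?rnorm_ge0 ?l2norm_ge0 ?bessel.
Qed.

End Frames.

Section StdBasis.
Context {R : realType}.
Definition std_basis N (i : 'I_N) : eucl N := (delta_mx i 0 : 'cV[R[i]]_N).

Lemma std_basis_on N : @orthonormal R (eucl N) N (@std_basis N).
Proof.
move=> i j; rewrite /hdot /= /edot (bigD1 i) //= big1.
  by rewrite !mxE !eqxx mul1r addr0 andbT conjc_nat.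
by move=> l li; rewrite !mxE (negPf li) mul0r.
Qed.

Lemma eucl_fin_dim N : @fin_dim R (eucl N) setT.
Proof.
exists N, (@std_basis N) => x _; exists (fun i => x i 0).
apply/colP => i; rewrite summxE (bigD1 i) //= big1.
  by rewrite !mxE !eqxx mulr1 addr0.
by move=> j ji; rewrite !mxE eq_sym (negPf ji) mulr0.
Qed.

Lemma expand_std N (M : 'M[R[i]]_N) (x : eucl N) : expand (@std_basis N) M x = M *m x.
Proof.
have cE (y : eucl N) : coords (@std_basis N) y = y.
  apply/colP => i; rewrite mxE /hdot /= /edot (bigD1 i) //= big1 => [|j ji].
    by rewrite mxE !eqxx conjc_nat mulr1 addr0.
  by rewrite mxE (negPf ji) conjc_nat mulr0.
by rewrite expandE cE -[LHS]cE uncoordsK //; exact: std_basis_on.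
Qed.
End StdBasis.

(** * Gram-Schmidt orthonormalisation *)

Section GramSchmidt.
Context {R : realType} {H : hilbertType R}.
Implicit Types (f g : nat -> H) (x y v : H).

(** Orthonormal families are extended step by step: indexing them by all natural
    numbers and looking at the first [N] entries avoids changes of type. *)
Definition initseg f N : 'I_N -> H := fun i => f i.
Arguments initseg : clear implicits.

(** The map V V^*: the orthogonal projection onto the span of an orthonormal
    family. *)
Definition proj N (e : 'I_N -> H) v := uncoords e (coords e v).

Lemma proj_linear N (e : 'I_N -> H) c x y :
  proj e (c *: x + y) = c *: proj e x + proj e y.
Proof. by rewrite /proj !linearP. Qed.

Lemma proj_sub N (e : 'I_N -> H) x y : proj e (x - y) = proj e x - proj e y.
Proof. by rewrite /proj !linearB. Qed.

Lemma proj_uncoords N (e : 'I_N -> H) c : orthonormal e ->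
  proj e (uncoords e c) = uncoords e c.
Proof. by move=> eo; rewrite /proj uncoordsK. Qed.

Lemma hdot_sub_proj N (e : 'I_N -> H) v i : orthonormal e ->
  hdot (v - proj e v) (e i) = 0.
Proof.
move=> eo; rewrite hdotBl /proj.
have := congr1 (fun c : 'cV_N => c i 0) (uncoordsK eo (coords e v)).
by rewrite !mxE => ->; rewrite subrr.
Qed.

Lemma proj_initseg_mono f g N M v : (N <= M)%N -> (forall i, (i < N)%N -> g i = f i) ->
  orthonormal (initseg g M) -> proj (initseg f N) v = v -> proj (initseg g M) v = v.
Proof.
move=> NM gf go vE.
have {vE} : v = uncoords (initseg f N) (coords (initseg f N) v) by [].
move: (coords _ v) => c {v}->.
have -> : uncoords (initseg f N) c = \sum_i c i 0 *: f i by [].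
rewrite /proj !linear_sum /=.
apply: eq_bigr => i _; rewrite !linearZ /=; congr (_ *: _).
rewrite -gf //.
have iM : (i < M)%N by apply: leq_trans NM.
have -> : g i = uncoords (initseg g M) (delta_mx (Ordinal iM) 0).
  rewrite /uncoords (bigD1 (Ordinal iM)) //= big1; first
    by rewrite mxE !eqxx scale1r addr0.
  by move=> j ji; rewrite mxE (negPf ji) scale0r.
by rewrite uncoordsK.
Qed.

(** The new vector is the normalised residual of [v]. *)
Lemma orthonormal_extend1 f N v : orthonormal (initseg f N) ->
  proj (initseg f N) v <> v ->
  exists g, [/\ orthonormal (initseg g N.+1), (forall i, (i < N)%N -> g i = f i),
    proj (initseg g N.+1) v = v &
    g N = ((rnorm (v - proj (initseg f N) v))^-1)%:C *: (v - proj (initseg f N) v)].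
Proof.
move=> fo vP; set r := v - proj _ v.
have r0 : rnorm r != 0.
  by apply/eqP => /rnorm0_eq0/eqP; rewrite subr_eq0 => /eqP /esym.
pose c := ((rnorm r)^-1)%:C; pose u := c *: r.
have cr : u = c *: r by [].
have fu i : (i < N)%N -> hdot u (f i) = 0.
  move=> iN; rewrite hdotZl; have := hdot_sub_proj v (Ordinal iN) fo.
  by rewrite /initseg => ->; rewrite mulr0.
have uu : hdot u u = 1.
  rewrite hdotZl hdotZr hdotE conjc_real -!rmorphM -[RHS](rmorph1 (real_complex R)) /=;
    congr (_%:C).
  by field.
clearbody u.
pose g i := if (i < N)%N then f i else u.
have go : orthonormal (initseg g N.+1).
  move=> i j; rewrite /initseg /g -(inj_eq val_inj) /=.
  case: ltnP => iN; case: ltnP => jN.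
  - by have := fo (Ordinal iN) (Ordinal jN); rewrite -(inj_eq val_inj).
  - rewrite hdot_conj fu // conjc0 ltn_eqF //; exact: leq_trans jN.
  - rewrite fu // gtn_eqF //; exact: leq_trans iN.
  - rewrite uu (_ : (i : nat) = j) ?eqxx //.
    have Hi := ltn_ord i; have Hj := ltn_ord j; lia.
have gf i : (i < N)%N -> g i = f i by rewrite /g => ->.
exists g; split=> //; last by rewrite /g ltnn.
have vE : v = uncoords (initseg g N.+1)
    (\col_i (if (i < N)%N then hdot v (f i) else (rnorm r)%:C)).
  rewrite /uncoords big_ord_recr /= !mxE ltnn /initseg {2}/g ltnn cr scalerA.
  rewrite -rmorphM mulfV //= scale1r.
  rewrite -[LHS](subrK (proj (initseg f N) v)) addrC; congr (_ + _).
  by apply: eq_bigr => i _; rewrite !mxE /= ltn_ord gf.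
by rewrite [in LHS]vE proj_uncoords.
Qed.

Lemma proj_subspace (S : set H) f N v : Defs.subspace S ->
  (forall i, (i < N)%N -> S (f i)) ->
  S (proj (initseg f N) v).
Proof.
move=> [S0 Sl] Sf; rewrite /proj /uncoords.
elim/big_rec: _ => [|i x _ Sx]; first exact: S0.
apply: Sl Sx; exact: Sf.
Qed.

(** The subspace [S] records where the new vectors lie: in the applications it is
    the whole space or the range of a projection. *)
Lemma gram_schmidt (S : set H) f N (vs : seq H) : Defs.subspace S ->
  orthonormal (initseg f N) -> (forall i, (i < N)%N -> S (f i)) ->
  (forall v, v \in vs -> S v) ->
  exists g
    M, [/\ (N <= M)%N, orthonormal (initseg g M), (forall i, (i < N)%N -> g i = f i),
    (forall i, (i < M)%N -> S (g i)) & forall v, v \in vs -> proj (initseg g M) v = v].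
Proof.
move=> Ss fo Sf; elim: vs => [|v vs IH] Sv; first by exists f, N; split.
have [|g [M [NM go gf Sg gvs]]] := IH; first by move=> w wv; apply: Sv;
  rewrite inE wv orbT.
have [gv|gv] := pselect (proj (initseg g M) v = v).
  by exists g, M; split=> // w; rewrite inE => /predU1P[->|/gvs].
have [h [ho hg hv hM]] := orthonormal_extend1 go gv.
exists h, M.+1; split=> //.
- exact: leqW.
- by move=> i iN; rewrite hg ?gf //; exact: leq_trans NM.
- move=> i; rewrite ltnS leq_eqVlt => /predU1P[->|iM]; last by rewrite hg //; exact: Sg.
  have [S0 Sl] := Ss; rewrite hM -[_ *: _]addr0; apply: (Sl) => //.
  rewrite addrC -scaleN1r; apply: Sl; first exact: proj_subspace.
  by apply: Sv; rewrite mem_head.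
- move=> w; rewrite inE => /predU1P[->//|wvs].
  exact: proj_initseg_mono (leqnSn _) hg ho (gvs _ wvs).
Qed.

(** A finite family never spans an infinite dimensional space, so there is always
    a vector with a nonzero residual. *)
Lemma orthonormal_extend f N m : ~ fin_dim [set: H] -> orthonormal (initseg f N) ->
  exists2 g, orthonormal (initseg g (N + m)) & forall i, (i < N)%N -> g i = f i.
Proof.
move=> Hinf fo; elim: m => [|m [g go gf]]; first by exists f; rewrite ?addn0.
have [v gv] : exists v, proj (initseg g (N + m)) v <> v.
  apply/not_existsP => allv; apply: Hinf.
  exists (N + m)%N, (initseg g (N + m)) => x _.
  exists (fun i => coords (initseg g (N + m)) x i 0).
  by rewrite -[LHS](contrapT (allv x)).
have [h [ho hg _ _]] := orthonormal_extend1 go gv.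
exists h; first by rewrite addnS.
by move=> i iN; rewrite hg ?gf //; exact: leq_trans (leq_addr _ _).
Qed.

End GramSchmidt.

Arguments initseg {R H} f N _.

(** * Matrix representations *)

(** If [p x = x] and [p y = 0], then [x = p (x + c y)] has norm at most that of
    [x + c y] for all scalars [c], so [x] and [y] are orthogonal: [p] is the
    orthogonal projection onto its range. *)
Lemma contraction_idem_selfadjoint (R : realType) (H : hilbertType R) (p : bop H) :
  p * p = p -> (forall x, rnorm (p x) <= rnorm x) ->
  forall x y, hdot (p x) y = hdot x (p y).
Proof.
move=> pp pc.
have ppx x : p (p x) = p x by rewrite -[in RHS]pp.
have orth x y : p x = x -> p y = 0 -> hdot x y = 0.
  move=> px py; apply: cabs0_eq0; apply/eqP; apply: contraT => h0.
  have hp : 0 < cabs (hdot x y) ^+ 2 by rewrite exprn_gt0 // lt_def h0 cabs_ge0.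
  set h := cabs (hdot x y) in h0 hp *.
  (* The increment [c y] has to decrease the norm of [x + c y]: [c] points
     against [hdot x y], and [t] makes the linear term win over the
     quadratic one. *)
  pose t := (1 + rnorm y ^+ 2)^-1.
  have t0 : 0 < 1 + rnorm y ^+ 2 by rewrite ltr_pwDl ?sqr_ge0.
  pose c : R[i] := - (t%:C * hdot x y).
  have cE : conjc c * hdot x y = (- t * h ^+ 2)%:C.
    rewrite [RHS]rmorphM /= cabs_sqr /c -mulNr -rmorphN conjcZ.
    by rewrite -mulrA [conjc _ * _]mulrC.
  have cn : cabs c = t * h.
    by rewrite /c cabsN cabsM cabsR ger0_norm ?invr_ge0 ?(ltW t0).
  have := pc (x + c *: y); rewrite bopD bopZ px py scaler0 addr0.
  rewrite -(@ler_pXn2r _ 2) ?nnegrE ?rnorm_ge0 // rnorm_sqrD rnormZ.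
  rewrite hdotZr cE cn /=.
  rewrite !exprMn -mulrA -addrA lerDl => le.
  have : 0 <= h ^+ 2 * (- t *+ 2 + t ^+ 2 * rnorm y ^+ 2).
    by apply: le_trans le _; rewrite le_eqVlt; apply/orP; left; apply/eqP; ring.
  rewrite pmulr_rge0 //.
  have -> : rnorm y ^+ 2 = t^-1 - 1 by rewrite invrK addrAC subrr add0r.
  have -> : - t *+ 2 + t ^+ 2 * (t^-1 - 1) = - t - t ^+ 2.
    by field; rewrite invr_neq0 // gt_eqF.
  have : 0 < t by rewrite invr_gt0.
  by move: (t) => s; nra.
move=> x y.
have pq z : p (z - p z) = 0 by rewrite bopD -scaleN1r bopZ ppx scaleN1r subrr.
transitivity (hdot (p x) (p y)).
  by apply/eqP; rewrite -subr_eq0 -hdotBr orth.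
by apply/esym/eqP; rewrite -subr_eq0 -hdotBl hdot_conj orth // conjc0.
Qed.

Lemma mulmx_ext (K : pzRingType) m n (M M' : 'M[K]_(m, n)) :
  (forall c : 'cV_n, M *m c = M' *m c) -> M = M'.
Proof.
move=> MM; apply/matrixP => i j.
by have := congr1 (fun v : 'cV_m => v i 0) (MM (delta_mx j 0)); rewrite -!colE !mxE.
Qed.

Section MatrixRepresentations.
Context {R : realType} {K : hilbertType R} (A : unitalOpAlg K).

(** The matrix of a finite dimensional unital representation in an orthonormal
    basis of its space.  The size may be 0. *)
Definition mxrep N (rho : {linear A -> 'M[R[i]]_N}) : Prop :=
  [/\ forall a b, rho (a * b) = rho a *m rho b, rho 1 = 1%:M &
      forall n (a : 'M[A]_n), cmx_mxnorm (map_mx rho a) <= oa_mxnorm a].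

Lemma oa_mxnorm_ge0 n (a : 'M[A]_n) : 0 <= oa_mxnorm a.
Proof. exact: bop_mxnorm_ge0. Qed.

Lemma oa_mxnorm11 (a : A) : oa_mxnorm (const_mx a : 'M[A]_1) <= opnorm a.
Proof.
apply: bop_mxnorm_le; first exact: opnorm_ge0.
move=> x;
  rewrite !big_ord1 !mxE -exprMn ler_pXn2r ?nnegrE ?mulr_ge0 ?rnorm_ge0 ?opnorm_ge0 //.
exact: opnorm_ub.
Qed.

Lemma opnorm1_le1 (H : hilbertType R) : opnorm (1 : bop H) <= 1.
Proof.
apply: (@opnorm_for_le _ _ _ _ 0) => //; first by rewrite rnorm0.
by move=> x; rewrite mul1r.
Qed.

Section OneRepresentation.
Context {H : hilbertType R} (pi : {linear A -> bop H}).
Hypothesis pi_rep : representation pi.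

Lemma rep_bounded (a : A) x : rnorm (pi a x) <= opnorm a * rnorm x.
Proof.
have := bop_mxnorm_ub (map_mx pi (const_mx a : 'M[A]_1)) (fun=> x).
rewrite !big_ord1 !mxE -exprMn ler_pXn2r ?nnegrE ?mulr_ge0 ?rnorm_ge0 ?bop_mxnorm_ge0 //.
move/le_trans; apply; rewrite ler_wpM2r ?rnorm_ge0 //.
exact: le_trans (pi_rep.2 _ _) (oa_mxnorm11 a).
Qed.

(** Representations need not be unital; [pi 1] is an orthogonal projection, and by
    [rep1l] and [rep1r] all of [pi] takes place in its range. *)
Lemma rep1_selfadjoint x y : hdot (pi 1 x) y = hdot x (pi 1 y).
Proof.
apply: contraction_idem_selfadjoint; first by rewrite -pi_rep.1 mulr1.
move=> z; apply: le_trans (rep_bounded _ _) _.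
by apply: le_trans (ler_wpM2r (rnorm_ge0 _) (opnorm1_le1 _)) _; rewrite mul1r.
Qed.

Lemma rep1l a x : pi 1 (pi a x) = pi a x.
Proof. by rewrite -[in RHS](mul1r a) pi_rep.1. Qed.
Lemma rep1r a x : pi a (pi 1 x) = pi a x.
Proof. by rewrite -[in RHS](mulr1 a) pi_rep.1. Qed.

Lemma mxrep_compress N (e : 'I_N -> H) : orthonormal e ->
  (forall x, pi 1 x = proj e x) -> mxrep (compress e \o pi).
Proof.
move=> eo pP; split=> [a b||m a].
- apply: mulmx_ext => c /=; rewrite -mulmxA !compress_mul.
  by rewrite -/(proj e (pi b (uncoords e c))) -pP rep1l pi_rep.1.
- by apply: mulmx_ext => c /=; rewrite compress_mul pP /proj !uncoordsK // mul1mx.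
- rewrite map_mx_comp; apply: le_trans (pi_rep.2 _ _); exact: cmx_mxnorm_compress.
Qed.

(** The frame [e] is an orthonormal basis of the range of [pi 1], so that
    [proj e] is [pi 1] and compressing to [e] loses nothing. *)
Lemma rep_frame : fin_dim (range (pi 1)) ->
  exists N (e : 'I_N -> H), [/\ orthonormal e, mxrep (compress e \o pi) &
    forall a, pi a = expand e (compress e (pi a))].
Proof.
move=> [n [u uP]].
pose S := [set x | pi 1 x = x].
have Ss : Defs.subspace S.
  by split=> [|c x y]; rewrite /S /= ?bop0 // bopD bopZ => -> ->.
have [||| g [N [_ go _ Sg gP]]] :=
  @gram_schmidt _ _ S (fun=> 0) 0 [seq pi 1 (u i) | i <- enum 'I_n] Ss.
- by case.
- by [].
- by move=> v /mapP[i _ ->]; rewrite /S /= rep1l.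
set e := initseg g N.
have eS i : pi 1 (e i) = e i by exact: (Sg i (ltn_ord i)).
have fixP x : proj e (pi 1 x) = pi 1 x.
  have [c xE] : exists c : 'I_n -> R[i], pi 1 x = \sum_i c i *: u i by apply: uP;
    exists x.
  rewrite -rep1l xE bop_sum /proj !linear_sum /=; apply: eq_bigr => i _.
  rewrite bopZ !linearZ /=; congr (_ *: _); apply: gP.
  by apply/mapP; exists i; rewrite ?mem_enum.
have Pfix x : pi 1 (proj e x) = proj e x.
  by rewrite /proj /uncoords bop_sum; apply: eq_bigr => i _; rewrite bopZ eS.
have Psa x y : hdot (proj e x) y = hdot x (proj e y).
  by rewrite /proj hdot_uncoords hdot_uncoordsr.
have pP x : pi 1 x = proj e x.
  apply: hdot_ext => z.
  by rewrite -fixP Psa rep1_selfadjoint Pfix -Psa.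
have piE a : pi a = expand e (compress e (pi a)).
  apply: val_inj; apply/funext => x /=.
  rewrite /expand_fun compress_mul -/(proj e x) -/(proj e (pi a (proj e x))).
  by rewrite -!pP rep1r rep1l.
by exists N, e; split=> //; exact: mxrep_compress.
Qed.
End OneRepresentation.

(** Let P be the projection onto the span of [e].  The operators T with
    P T = T = T P form a norm closed self-adjoint algebra; it contains the range
    of the representation, hence also the C*-algebra generated by it, which
    therefore maps into the finite dimensional range of P. *)
Lemma mxrep_expand (H : hilbertType R) N (rho : {linear A -> 'M[R[i]]_N})
  (e : 'I_N -> H) :
  orthonormal e -> mxrep rho -> fin_dim_representation (expand e \o rho).
Proof.
move=> eo [rhoM rho1 rhoc]; split.
  split=> [a b|n a] /=; first by rewrite rhoM expandM.
  rewrite map_mx_comp; apply: le_trans (rhoc _ _); exact: bop_mxnorm_expand.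
exists N, e.
have Psa x y : hdot (proj e x) y = hdot x (proj e y).
  by rewrite /proj hdot_uncoords hdot_uncoordsr.
have rproj x : rnorm (proj e x) <= rnorm x by rewrite rnorm_uncoords ?bessel.
pose B := [set T : bop H | forall x, proj e (T x) = T x /\ T (proj e x) = T x].
pose V := [set x : H | proj e x = x].
suff sub : closed_span [set (T : bop H) x | T in cstar_generated (range (expand e \o rho))
      & x in [set: H]] `<=` V.
  move=> x /sub <-; by exists (fun i => coords e x i 0).
apply: smallest_sub.
  split.
    split; first by rewrite /V /= /proj !linear0.
    by move=> c x y; rewrite /V /= /proj !linearP /= => -> ->.
  have PE x : (expand e 1%:M - 1 : bop H) x = proj e x - x.
    by rewrite -[LHS]/(expand e 1%:M x - x) expandE mul1mx.
  have -> : V = (expand e 1%:M - 1 : bop H) @^-1` [set 0].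
    rewrite eqEsubset; split=> x; rewrite /V /preimage /mkset PE.
      by move=> ->; rewrite subrr.
    by move/eqP; rewrite subr_eq0 => /eqP.
  apply: closed_comp;
    last exact/accessible_closed_set1/hausdorff_accessible/norm_hausdorff.
  by move=> x _; exact: bop_continuous.
move=> _ [T TB [x _ <-]].
suff : B T by move=> /(_ x)[].
move: T TB; apply: smallest_sub; last first.
  by move=> _ [a _ <-] y /=; rewrite /expand_fun /proj !uncoordsK.
split; first split; first split.
- by move=> y; rewrite /proj !linear0.
- move=> c S T SB TB y; have [S1 S2] := SB y; have [T1 T2] := TB y.
  have sumE z : (c *: S + T) z = c *: S z + T z by [].
  by rewrite !sumE proj_linear S1 T1 S2 T2.
- move=> S T SB TB y /=; have [S1 S2] := SB (T y); have [T1 T2] := TB y.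
  by split; rewrite ?S1 // T2.
- move=> T TB y.
  have le (z : H) : (forall S, B S -> rnorm z <= opnorm (T - S) * (rnorm y *+ 2)) ->
    z = 0.
    move=> zS; apply: rnorm0_eq0; apply/eqP; rewrite eq_le rnorm_ge0 andbT.
    apply: (@le0_small _ _ (rnorm y *+ 2)) => [|d d0]; first
      by rewrite mulrn_wge0 ?rnorm_ge0.
    have [S SB /ltW dS] := TB _ d0; apply: le_trans (zS _ SB) _.
    by rewrite ler_wpM2r // mulrn_wge0 ?rnorm_ge0.
  split; apply/eqP; rewrite -subr_eq0; apply/eqP/le => S SB; have [S1 S2] := SB y;
    have subE z : (T - S) z = T z - S z by [].
    have -> : proj e (T y) - T y = proj e ((T - S) y) - (T - S) y.
      by rewrite subE proj_sub S1 opprB addrA subrK.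
    apply: le_trans (rnormD _ _) _; rewrite rnormN mulr2n mulrDr.
    by apply: lerD; last exact: opnorm_ub; apply: le_trans (rproj _) (opnorm_ub _ _).
  have -> : T (proj e y) - T y = (T - S) (proj e y) - (T - S) y.
    by rewrite !subE S2 opprB addrA subrK.
  apply: le_trans (rnormD _ _) _; rewrite rnormN mulr2n mulrDr.
  apply: lerD; last exact: opnorm_ub.
  by apply: le_trans (opnorm_ub _ _) _; rewrite ler_wpM2l ?rproj ?opnorm_ge0.
- move=> T S TB TS y; split; apply: hdot_ext => z.
    rewrite Psa hdot_conj -TS; have [_ ->] := TB z.
    by rewrite TS -hdot_conj.
  rewrite hdot_conj -TS -Psa; have [-> _] := TB z.
  by rewrite TS -hdot_conj.
Qed.

End MatrixRepresentations.

(** * Weak-star and weak operator neighbourhoods *)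

Section PointwiseTopology.
Context {R : realType} {S : choiceType} {U : Type}.
Variable f : S -> {ptws U -> R[i]^o}.

(** Both the weak-star topology and the weak operator topology are initial for a
    map into functions with pointwise convergence; their neighbourhoods are
    described by finitely many evaluations and a precision. *)
Lemma nbhs_initial_ptws (s : initial_topology f) (B : set S) :
  nbhs s B <-> exists n (u : 'I_n -> U) (e : R), 0 < e /\
    forall t, (forall i, cabs (f t (u i) - f s (u i)) < e) -> B t.
Proof.
split=> [sB|[n [u [e [e0 uB]]]]].
  pose base := [set B : set S | exists n (u : 'I_n -> U) (e : R), 0 < e /\
    forall t, (forall i, cabs (f t (u i) - f s (u i)) < e) -> B t].
  have baseF : Filter base.
    split.
    - by by exists 0%N, (fun i : 'I_0 => False_rect U (notF (ltn_ord i))), 1.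
    - move=> P Q [n1 [u1 [e1 [e10 P1]]]] [n2 [u2 [e2 [e20 P2]]]].
      exists (n1 + n2)%N, (fun i => match fintype.split i with inl j => u1 j | inr j =>
        u2 j end).
      exists (Num.min e1 e2); split; first by rewrite lt_min e10.
      move=> t le; split.
        apply: P1 => i; have := le (lshift n2 i).
        by rewrite (unsplitK (inl i)) lt_min => /andP[].
      apply: P2 => i; have := le (rshift n1 i).
      by rewrite (unsplitK (inr i)) lt_min => /andP[].
    - move=> P Q PQ [n [u [e [e0 Pu]]]]; exists n, u, e; split=> // t /Pu; exact: PQ.
  have [_ [[C oC <-] Cs CB]] := sB.
  suff : cvg_to (fmap f base) (nbhs (f s : {ptws U -> R[i]^o})).
    have nC : nbhs (f s) C by exact: open_nbhs_nbhs.
    by move=> /(_ C nC) [n [u [e [e0 Pu]]]]; exists n, u, e; split=> // t /Pu; exact: CB.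
  apply/cvg_sup => u D /= [_ [[E oE <-] Es ED]].
  have : nbhs (f s u : R[i]^o) E by exact: open_nbhs_nbhs.
  move=> /nbhs_ballP[e e0 eE]; exists 1%N, (fun=> u), (complex.Re e); split.
    by move: e0; rewrite /= ltcE => /andP[].
  move=> t /(_ ord0) tE; apply: ED => /=; apply: eE.
  rewrite -ball_normE /= distrC -cabsE -[e]RRe_real ?gtr0_real // ltcR //.
suff near1 i : nbhs s [set t | cabs (f t (u i) - f s (u i)) < e].
  by move/filter_forall: near1; apply: filterS => t; exact: uB.
have : nbhs (f s) [set g : {ptws U -> R[i]^o} | cabs (g (u i) - f s (u i)) < e].
  have bC : nbhs (f s (u i) : R[i]^o) (ball (f s (u i) : R[i]^o) e%:C).
    by apply: nbhsx_ballx; rewrite ltcR.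
  move: bC; rewrite nbhsE => -[E [oE cE] EB].
  have /cvg_sup/(_ (u i)) : cvg_to (nbhs (f s : {ptws U -> R[i]^o}))
    (nbhs (f s : {ptws U -> R[i]^o})) by [].
  apply; exists (fun g : U -> R[i] => E (g (u i))); split=> //=.
    by exists E.
  move=> g /EB; by rewrite /= -ball_normE /= distrC -cabsE ltcR.
rewrite nbhsE => -[E [oE Es] EB].
exists (f @^-1` E); split=> //; first by exists E.
by move=> t /EB.
Qed.
End PointwiseTopology.

(** * Residual finite dimensionality from weak operator approximation *)

Lemma net_filter_proper (I : Type) (le : I -> I -> Prop) :
  directed le -> ProperFilter (net_filter le).
Proof.
move=> [[i0] lexx letr lub]; apply: filter_from_proper.
  apply: filter_from_filter; first by exists i0.
  move=> i j _ _; have [k [ik jk]] := lub i j.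
  by exists k => // l /= kl; split; apply: letr kl.
by move=> i _; exists i; exact: lexx.
Qed.

Section WOT.
Context {R : realType} {H : hilbertType R}.

Lemma wot_nbhsP (T : wot H) (B : set (bop H)) : nbhs T B <->
  exists n (u : 'I_n -> H * H) (e : R), 0 < e /\ forall S : bop H,
    (forall i, cabs (hdot (S (u i).1) (u i).2 - hdot ((T : bop H) (u i).1) (u i).2) < e)
      -> B S.
Proof. exact: nbhs_initial_ptws. Qed.

Lemma wot_cvg_hdot (I : Type) (F : set_system I) (T_ : I -> bop H) (T : bop H)
  x y (e : R) :
  Filter F -> ((fun i => T_ i : wot H) @ F --> (T : wot H)) -> 0 < e ->
  F [set i | cabs (hdot (T_ i x) y - hdot (T x) y) < e].
Proof.
move=> FF TF e0.
apply: (TF [set S : bop H | cabs (hdot (S x) y - hdot (T x) y) < e]); apply/wot_nbhsP.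
by exists 1%N, (fun=> (x, y)), e; split=> // S /(_ ord0).
Qed.
End WOT.

Section WOTtoRFD.
Context {R : realType} {K : hilbertType R} (A : unitalOpAlg K).

Definition fd_norms n (a : 'M[A]_n) : set R := [set r |
  exists (H : hilbertType R) (pi : {linear A -> bop H}),
    [/\ fin_dim [set: H], representation pi & r = bop_mxnorm (map_mx pi a)]].

Lemma fd_norms_ub n (a : 'M[A]_n) : ubound (fd_norms a) (oa_mxnorm a).
Proof. by move=> _ [H [pi [_ pir ->]]]; exact: pir.2. Qed.

(** The standard basis of C^N makes a representation out of [rho], and compressing
    it back to that basis recovers [rho]. *)
Lemma mxrep_fd_norm N (rho : {linear A -> 'M[R[i]]_N}) n (a : 'M[A]_n) :
  mxrep rho -> exists2 r, fd_norms a r & cmx_mxnorm (map_mx rho a) <= r.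
Proof.
move=> rhor; exists (bop_mxnorm (map_mx (expand (@std_basis R N) \o rho) a)).
  exists (eucl N), (expand (@std_basis R N) \o rho); split=> //;
    first exact: eucl_fin_dim.
  by have [] := mxrep_expand (@std_basis_on R N) rhor.
apply: le_trans _ (cmx_mxnorm_compress (@std_basis_on R N) _).
rewrite -map_mx_comp le_eqVlt; apply/orP; left; apply/eqP; congr cmx_mxnorm.
by apply/matrixP => i j; rewrite !mxE /= compress_expand //; exact: std_basis_on.
Qed.

(** The zero representation on the zero space. *)
Lemma fd_norms0 n (a : 'M[A]_n) : fd_norms a !=set0.
Proof.
exists (bop_mxnorm (map_mx (\0 : {linear A -> bop (eucl 0)}) a)).
exists (eucl 0), \0; split=> //; first exact: eucl_fin_dim.
split=> [x y|m b]; first by rewrite /= mul0r.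
apply: bop_mxnorm_le; first exact: oa_mxnorm_ge0.
move=> x; rewrite big1 => [|i _]; first exact: mulr_ge0 (sqr_ge0 _) (sum_sqr_ge0 _).
by rewrite big1 ?rnorm0 ?expr0n // => j _; rewrite mxE.
Qed.

Lemma fd_rep_fin_dim_range (H : hilbertType R) (pi : {linear A -> bop H}) (a : A) :
  fin_dim_representation pi -> fin_dim (range (pi a)).
Proof.
move=> [_ [n [e eP]]]; exists n, e => x [y _ <-]; apply: eP.
apply: sub_gen_smallest; exists (pi a); last by exists y.
by apply: sub_gen_smallest; exists a.
Qed.

Lemma oa_val_linear : linear (@oa_val R K A).
Proof. by []. Qed.
HB.instance Definition _ :=
  GRing.isLinear.Build R[i] A (bop K) *:%R (@oa_val R K A) oa_val_linear.

Lemma oa_val_rep : representation (@oa_val R K A : {linear A -> bop K}).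
Proof. by split. Qed.

(** For a tuple [x] of vectors, [|| a x ||^2 = <a x, a x>] is approximated by
    [<pi_l(a) x, a x>], which is at most [s || x || || a x ||] as soon as [s] bounds
    all the norms of [a] in finite dimensional representations. *)
Lemma wot_approximable_rfd : wot_approximable A -> rfd A.
Proof.
move=> wA n a; rewrite -/(fd_norms a); apply/eqP; rewrite eq_le; apply/andP; split;
  last first.
  by apply: ge_sup; [exact: fd_norms0|exact: fd_norms_ub].
set s := sup _.
have s_ub r : fd_norms a r -> r <= s.
  by move=> rS; apply: ub_le_sup rS; exists (oa_mxnorm a); exact: fd_norms_ub.
have s0 : 0 <= s.
  have [r ra] := fd_norms0 a; apply: le_trans (s_ub _ ra).
  by have [H [pi [_ _ ->]]] := ra; exact: bop_mxnorm_ge0.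
have [I [le [pi_ [dir pifd picvg]]]] := wA K _ oa_val_rep.
have FF := net_filter_proper dir.
have piS l : bop_mxnorm (map_mx (pi_ l) a) <= s.
  have [|N [e [eo rhor piE]]] := rep_frame (pifd l).1; first exact: fd_rep_fin_dim_range.
  have [r ra le_r] := mxrep_fd_norm a rhor.
  apply: le_trans (s_ub _ ra); apply: le_trans le_r.
  apply: le_trans _ (bop_mxnorm_expand eo _).
  rewrite -map_mx_comp le_eqVlt; apply/orP; left; apply/eqP; congr bop_mxnorm.
  by apply/matrixP => i j; rewrite !mxE /= -piE.
apply: bop_mxnorm_le => // x.
set y := fun i => \sum_j map_mx (@oa_val R K A) a i j (x j).
rewrite -/(y _).
rewrite -l2norm_leE //.
set X := l2norm _ x; set Y := l2norm _ _.
suff le2 : Y ^+ 2 <= s * X * Y.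
  have [->|Y0] := eqVneq Y 0; first by rewrite mulr_ge0 ?l2norm_ge0.
  by rewrite -(@ler_pM2r _ Y) -?expr2 // lt_def Y0 l2norm_ge0.
rewrite -subr_le0; apply: (@le0_small _ _ (n * n)%:R) => // d d0.
have : \forall l \near net_filter le, forall i j,
    cabs (hdot (pi_ l (a i j) (x j)) (y i) - hdot (oa_val (a i j) (x j)) (y i)) < d.
  apply: filter_forall => i; apply: filter_forall => j.
  exact: wot_cvg_hdot (picvg _) d0.
move=> /filter_ex[l Hl].
pose z i := \sum_j pi_ l (a i j) (x j).
have YE :
  Y ^+ 2 = \sum_i complex.Re (hdot (z i) (y i)) +
  \sum_i complex.Re (hdot (y i - z i) (y i)).
  rewrite l2norm_sqr -big_split; apply: eq_bigr => i _ /=.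
  by rewrite -ReD -hdotDl addrC subrK rnorm_sqr.
rewrite YE addrAC ler_wnDl ?subr_le0 //.
  have ZX : l2norm (@rnorm R K) z <= s * X.
    rewrite l2norm_leE //.
    have := bop_mxnorm_ub (map_mx (pi_ l) a) x.
    rewrite [X in X <= _](eq_bigr (fun i => rnorm (z i) ^+ 2)) => [|i _]; last first.
      by congr (rnorm _ ^+ 2); apply: eq_bigr => j _; rewrite mxE.
    move/le_trans; apply; rewrite ler_wpM2r ?sum_sqr_ge0 //.
    by rewrite ler_pXn2r ?nnegrE ?bop_mxnorm_ge0 ?piS.
  apply: (@le_trans _ _ (l2norm (@rnorm R K) z * Y)); last
    by rewrite ler_wpM2r ?l2norm_ge0.
  apply: le_trans (sum_CS _ _ _); apply: ler_sum => i _.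
  exact: le_trans (Re_le_cabs _) (hdot_CS _ _).
have -> : d * (n * n)%:R = \sum_(i < n) \sum_(j < n) d.
  by rewrite !sumr_const !card_ord -mulrnA mulr_natr.
apply: ler_sum => i _; apply: le_trans (Re_le_cabs _) _.
rewrite /y /z -sumrB hdot_suml.
apply: le_trans (cabs_sum _ _ _) _; apply: ler_sum => j _.
by rewrite mxE hdotBl cabsB ltW.
Qed.
End WOTtoRFD.

(** * Matrix states as corners of matrix representations *)

Section MatrixStates.
Context {R : realType} {K : hilbertType R} (A : unitalOpAlg K).

Lemma dual_nbhsP (phi : dual A) (B : set (dual A)) : nbhs phi B <->
  exists (s : seq A) (e : R), 0 < e /\ forall psi : dual A,
    (forall a, a \in s -> cabs (psi a - phi a) < e) -> B psi.
Proof.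
split=> [/nbhs_initial_ptws[n [u [e [e0 uB]]]]|[s [e [e0 sB]]]].
  exists (codom u), e; split=> // psi psie; apply: uB => i; exact/psie/codom_f.
apply/nbhs_initial_ptws; exists (size s), (tnth (in_tuple s)), e; split=> // psi psie.
by apply: sB => a /(tnthP (in_tuple s))[k ->]; exact: psie.
Qed.

Lemma mxdual_nbhsP n (phi : 'M[dual A]_n) (B : set 'M[dual A]_n) : nbhs phi B <->
  exists (s : seq A) (e : R), 0 < e /\ forall psi : 'M[dual A]_n,
    (forall a i j, a \in s -> cabs (psi i j a - phi i j a) < e) -> B psi.
Proof.
split=> [[P Pphi PB]|[s [e [e0 sB]]]].
  have H (p : 'I_n * 'I_n) := (dual_nbhsP _ _).1 (Pphi p.1 p.2).
  have /choice[s Hs] := H; have /choice[e He] := Hs.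
  exists (flatten [seq s p | p <- enum [set: 'I_n * 'I_n]]), (\big[Num.min/1]_p e p).
  split; first by apply: lt_bigmin => [|p _]; [exact: ltr01|have [] := He p].
  move=> psi psie; apply: PB => i j; apply: (He (i, j)).2 => a aS.
  apply: lt_le_trans (bigmin_le _ (i, j) e); apply: psie.
  by apply/flatten_mapP; exists (i, j); rewrite ?mem_enum ?inE.
exists (fun
  i j => [set psi : dual A | forall a, a \in s -> cabs (psi a - phi i j a) < e]).
  by move=> i j; apply/dual_nbhsP; exists s, e.
by move=> psi Qpsi; apply: sB => a i j; exact: Qpsi.
Qed.

(** Unitality of the compressed map asks that the frame lie in the range of
    [pi 1]. *)
Lemma compress_state (H : hilbertType R) (pi : {linear A -> bop H}) n (e : 'I_n -> H) :
  representation pi -> orthonormal e -> (forall i, pi 1 (e i) = e i) ->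
  exists2 phi : 'M[dual A]_n, matrix_states phi &
    forall a, mxdual_fun phi a = compress e (pi a).
Proof.
move=> pir eo pie.
have bnd i j : (fun a : A => hdot (pi a (e j)) (e i) : R[i]^o)
  \in @bounded_functional R K A.
  apply/asboolP; split.
    by move=> c a b; rewrite linearP /= hdotDl hdotZl.
  exists (rnorm (e j) * rnorm (e i)) => a.
  apply: le_trans (hdot_CS _ _) _; rewrite mulrAC ler_wpM2r ?rnorm_ge0 //.
  by rewrite mulrC; exact: rep_bounded.
pose phi : 'M[dual A]_n := \matrix_(i, j) Dual (bnd i j).
have phiE a : mxdual_fun phi a = compress e (pi a).
  by apply/matrixP => i j; rewrite !mxE.
exists phi => //; split.
  by rewrite phiE; apply/matrixP => i j; rewrite !mxE pie eo eq_sym.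
move=> m a.
have -> : map_mx (mxdual_fun phi) a = map_mx (compress e) (map_mx pi a).
  by apply/matrixP => i j; rewrite !mxE phiE.
exact: le_trans (cmx_mxnorm_compress eo _) (pir.2 _ _).
Qed.

Lemma mxrep_zero : mxrep (\0 : {linear A -> 'M[R[i]]_0}).
Proof.
split=> [a b||n a]; [by apply/matrixP => -[] | by apply/matrixP => -[] |].
apply: cmx_mxnorm_le => [|x]; first exact: bop_mxnorm_ge0.
rewrite big1 => [|i _]; first exact: mulr_ge0 (sqr_ge0 _) (sum_sqr_ge0 _).
by rewrite euclnorm_sqr big_ord0.
Qed.

(** Since [phi] and [pi] are unital, [ws] is a left inverse of [w], so [w] sends
    the standard basis to an orthonormal family.  In an orthonormal basis that
    begins with this family, [phi] is the upper left corner of [pi]. *)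
Lemma fd_state_frame n (phi : 'M[dual A]_n) : fin_dim_matrix_states phi ->
  exists m (rho : {linear A -> 'M[R[i]]_(n + m)}), mxrep rho /\
    forall a i j, rho a (lshift m i) (lshift m j) = phi i j a.
Proof.
move=> [[phi1 _] [H [w [ws [pi [[N0 [u uP]] wn whd [pir pi1] phiE]]]]]].
have wsw v : ws (w v) = v.
  by have := phiE 1 v; rewrite phi1 mul1mx pi1.
pose f i : H := if insub i is Some j then w (delta_mx (j : 'I_n) 0) else 0.
have fE (i : 'I_n) : f i = w (delta_mx i 0) by rewrite /f valK.
have fd (i : 'I_n) x : hdot (f i) x = conjc (ws x i 0).
  rewrite fE whd (bigD1 i) //= big1; first by rewrite mxE !eqxx mul1r addr0.
  by move=> j ji; rewrite mxE (negPf ji) mul0r.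
have fo : orthonormal (initseg f n).
  by move=> i j; rewrite /initseg fd fE wsw mxE eqxx andbT conjc_nat.
have [||| g [N [nN go gf _ gP]]] := @gram_schmidt _ _ setT f n (codom u) _ fo.
- by split.
- by [].
- by [].
have gT x : proj (initseg g N) x = x.
  have [c ->] := uP x I; rewrite /proj !linear_sum /=; apply: eq_bigr => i _.
  by rewrite !linearZ /=; congr (_ *: _); exact/gP/codom_f.
have [m NE] : exists m, N = (n + m)%N by exists (N - n)%N; rewrite subnKC.
move: go gP gT; rewrite {N nN}NE => go _ gT.
exists m, (compress (initseg g (n + m)) \o pi); split.
  apply: mxrep_compress => // x; by rewrite gT pi1.
have gE (i : 'I_n) : g (lshift m i) = f i by exact: (gf i (ltn_ord i)).
move=> a i j; rewrite /= mxE /initseg !gE hdot_conj fd conjcK fE.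
have /(congr1 (fun c : 'cV_n => c i 0)) := phiE a (delta_mx j 0).
by rewrite -colE !mxE.
Qed.

(** Density is assumed for matrix states of positive size only; the state with
    values in the zero ring of matrices is the corner of a representation of size 0. *)
Lemma dense_frame n (phi : 'M[dual A]_n) (s : seq A) (e : R) :
  fin_dim_matrix_states_dense A -> matrix_states phi -> 0 < e ->
  exists m (rho : {linear A -> 'M[R[i]]_(n + m)}), mxrep rho /\
    forall a i j, a \in s -> cabs (rho a (lshift m i) (lshift m j) - phi i j a) < e.
Proof.
move=> dns phiS e0; case: n phi phiS => [|n] phi phiS.
  by exists 0%N, \0; split=> [|a []//]; exact: mxrep_zero.
have [|psi [psiS psie]] := dns n.+1 isT phi phiS
    [set psi : 'M[dual A]_n.+1 | forall a i j, a \in s -> cabs (psi i j a - phi i j a) <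
      e].
  by apply/mxdual_nbhsP; exists s, e.
have [m [rho [rhor rhoE]]] := fd_state_frame psiS.
exists m, rho; split=> // a i j aS; rewrite rhoE; exact: psie.
Qed.

End MatrixStates.

(** * Weak operator approximation from density of matrix states *)

Section DenseToWOT.
Context {R : realType} {K : hilbertType R} (A : unitalOpAlg K).
Context {H : hilbertType R} (pi : {linear A -> bop H}).
Hypothesis dense : fin_dim_matrix_states_dense A.
Hypothesis pi_rep : representation pi.

(** The vectors [xs] are seen by [pi] through their projections [pi 1 x], which span
    the range of an orthonormal family [g].  The approximating representation uses
    a matrix representation of size [n + m] whose first [n] basis vectors are [g];
    the others are chosen orthogonal to [xs], where infinite dimension is used. *)
Lemma wot_approx_finite (s : seq A) (xs : seq H) (eps : R) :
  ~ fin_dim [set: H] -> 0 < eps ->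
  exists2 pi' : {linear A -> bop H}, fin_dim_representation pi' &
    forall a x y, a \in s -> x \in xs -> y \in xs ->
      cabs (hdot (pi' a x) y - hdot (pi a x) y) < eps.
Proof.
move=> Hinf e0.
pose S := [set x | pi 1 x = x].
have Ss : Defs.subspace S.
  by split=> [|c x y]; rewrite /S /= ?bop0 // bopD bopZ => -> ->.
have [||| g [n [_ go _ Sg gP]]] :=
  @gram_schmidt _ _ S (fun=> 0) 0 [seq pi 1 x | x <- xs] Ss.
- by case.
- by [].
- by move=> v /mapP[x _ ->]; rewrite /S /= rep1l.
have gS (i : 'I_n) : pi 1 (initseg g n i) = initseg g n i by exact: (Sg i (ltn_ord i)).
have [phi phiS phiE] := compress_state pi_rep go gS.
pose X := \sum_(x <- xs) rnorm x.
have X0 : 0 <= X by rewrite sumr_ge0 // => x _; exact: rnorm_ge0.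
have xX x : x \in xs -> rnorm x <= X.
  move=> xxs; rewrite /X (big_rem x) //= lerDl sumr_ge0 // => y _; exact: rnorm_ge0.
(* The matrix coefficients of [pi'] and [pi] at two vectors of [xs] are sums of
   [n * n] entries, each weighted by two coordinates bounded by [X]. *)
pose C := (n * n)%:R * X ^+ 2.
have C1 : 0 < C + 1 by rewrite ltr_wpDl // mulr_ge0 ?sqr_ge0.
have [|m [rho [rhor rhoE]]] := dense_frame s dense phiS (e := eps / (C + 1)).
  by rewrite divr_gt0.
have [||| g1 [M [nM g1o g1g _ g1P]]] := @gram_schmidt _ _ setT g n xs _ go.
- by split.
- by [].
- by [].
have [g2 g2o g2g] := orthonormal_extend m Hinf g1o.
(* [g2] extends an orthonormal basis [g1] of a space containing [g] and [xs];
   its entries from [M] on are orthogonal to [xs]. *)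
pose e' (i : 'I_(n + m)) : H :=
  match fintype.split i with inl j => g2 j | inr k => g2 (M + k)%N end.
have e'l (i : 'I_n) : e' (lshift m i) = g i.
  by rewrite /e' (unsplitK (inl i)) g2g ?g1g //; exact: leq_trans nM.
have e'r (k : 'I_m) : e' (rshift n k) = g2 (M + k)%N.
  by rewrite /e' (unsplitK (inr k)).
have g2on i j : (i < M + m)%N -> (j < M + m)%N -> hdot (g2 i) (g2 j) = (i == j)%:R.
  by move=> iM jM; have := g2o (Ordinal iM) (Ordinal jM).
have e'o : orthonormal e'.
  move=> i j; case: (split_ordP i) => k ->; case: (split_ordP j) => l ->.
  - by rewrite !e'l (go k l) eq_lshift.
  - rewrite e'l e'r -(g1g k) // -(g2g k) ?(leq_trans (ltn_ord k)) // g2on ?ltn_add2l //;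
      last first.
      by rewrite (leq_trans (ltn_ord k)) // (leq_trans nM) ?leq_addr.
    by rewrite eq_lrshift ltn_eqF // (leq_trans (ltn_ord k)) // (leq_trans nM) ?leq_addr.
  - rewrite e'l e'r -(g1g l) // -(g2g l) ?(leq_trans (ltn_ord l)) // g2on ?ltn_add2l //;
      last first.
      by rewrite (leq_trans (ltn_ord l)) // (leq_trans nM) ?leq_addr.
    by rewrite eq_rlshift gtn_eqF // (leq_trans (ltn_ord l)) // (leq_trans nM) ?leq_addr.
  - by rewrite !e'r g2on ?ltn_add2l // eqn_add2l eq_rshift.
exists (expand e' \o rho); first exact: mxrep_expand.
have cl x (i : 'I_n) : coords e' x (lshift m i) 0 = hdot x (g i) by rewrite mxE e'l.
have cr x (k : 'I_m) : x \in xs -> coords e' x (rshift n k) 0 = 0.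
  move=> /g1P <-; rewrite mxE e'r /proj /uncoords hdot_suml big1 // => i _.
  rewrite hdotZl /initseg -g2g // g2on ?ltn_add2l ?(leq_trans (ltn_ord i)) ?leq_addr //.
  by rewrite ltn_eqF ?mulr0 //; exact: leq_trans (leq_addr _ _).
move=> a x y aS xxs yxs.
have -> : hdot ((expand e' \o rho) a x) y =
    \sum_(i < n) \sum_(j < n) rho a (lshift m i) (lshift m j) * hdot x (g j)
      * conjc (hdot y (g i)).
  rewrite /= hdot_uncoords /edot big_split_ord /= [X in _ + X]big1 ?addr0 => [|k _];
    last first.
    by rewrite cr // conjc0 mulr0.
  apply: eq_bigr => i _;
    rewrite cl mxE big_split_ord /= [X in _ + X]big1 ?addr0 => [|k _]; last first.
    by rewrite cr // mulr0.
  by rewrite mulr_suml; apply: eq_bigr => j _; rewrite cl.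
have -> : hdot (pi a x) y =
    \sum_(i < n) \sum_(j < n) phi i j a * hdot x (g j) * conjc (hdot y (g i)).
  have px z : z \in xs -> pi 1 z = uncoords (initseg g n) (coords (initseg g n) z).
    move=> zxs; rewrite -[pi 1 z]gP; last by apply/mapP; exists z.
    rewrite /proj; congr uncoords; apply/colP => i;
      rewrite !mxE rep1_selfadjoint // gS //.
  rewrite -[pi a x]rep1l // rep1_selfadjoint // -[pi a x]rep1r // !px //.
  rewrite hdot_uncoordsr -compress_mul -phiE; apply: eq_bigr => i _.
  rewrite !mxE mulr_suml; apply: eq_bigr => j _.
  by rewrite !mxE.
rewrite -sumrB; under eq_bigr do rewrite -sumrB.
apply: (@le_lt_trans _ _ (\sum_(i < n) \sum_(j < n) eps / (C + 1) * X ^+ 2)).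
  apply: le_trans (cabs_sum _ _ _) _; apply: ler_sum => i _.
  apply: le_trans (cabs_sum _ _ _) _; apply: ler_sum => j _.
  rewrite -mulrBl -mulrBl -mulrA !cabsM cabsJ.
  have le z k : z \in xs -> cabs (hdot z (g (k : 'I_n))) <= X.
    move=> /xX; apply: le_trans; apply: le_trans (hdot_CS _ _) _.
    by have := rnorm_orthonormal go k; rewrite /initseg => ->; rewrite mulr1.
  apply: ler_pM; rewrite ?mulr_ge0 ?cabs_ge0 //; first by rewrite ltW // rhoE.
  by rewrite expr2 ler_pM ?cabs_ge0 ?le.
rewrite !sumr_const !card_ord -mulrnA -[ltLHS]mulr_natr.
have -> : eps / (C + 1) * X ^+ 2 * (n * n)%:R = eps * (C / (C + 1)).
  by rewrite /C; ring.
by rewrite gtr_pMr // ltr_pdivrMr // mul1r ltrDl.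
Qed.

End DenseToWOT.

(** The net is indexed by finitely many operators, finitely many vectors and a
    precision, ordered by inclusion. *)
Lemma dense_wot_approximable (R : realType) (K : hilbertType R) (A : unitalOpAlg K) :
  fin_dim_matrix_states_dense A -> wot_approximable A.
Proof.
move=> dns H pi pir.
have [[n [u uP]]|Hinf] := pselect (fin_dim [set: H]).
  exists unit, (fun _ _ => True), (fun=> pi); split.
  - split; [exact: (inhabits tt)|by []|by []|by move=> _ _; exists tt].
  - by move=> _; split=> //; exists n, u => x _; exact: uP.
  - by move=> a B /nbhs_singleton Ba; exists tt.
pose I := (seq A * seq H * nat)%type.
have eps0 (k : nat) : 0 < k.+1%:R^-1 :> R by rewrite invr_gt0.
have /choice[pi_ pi_P] : forall i : I, exists pi' : {linear A -> bop H},
    fin_dim_representation pi' /\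
    forall a x y, a \in i.1.1 -> x \in i.1.2 -> y \in i.1.2 ->
      cabs (hdot (pi' a x) y - hdot (pi a x) y) < i.2.+1%:R^-1.
  move=> i; have [pi' ? ?] := wot_approx_finite dns pir i.1.1 i.1.2 Hinf (eps0 i.2).
  by exists pi'.
pose le (i j : I) :=
  [/\ {subset i.1.1 <= j.1.1}, {subset i.1.2 <= j.1.2} & (i.2 <= j.2)%N].
exists I, le, pi_; split.
- split.
  + exact: (inhabits ([::], [::], 0%N)).
  + by move=> i; split.
  + move=> i j k [ij1 ij2 ij3] [jk1 jk2 jk3]; split; last exact: leq_trans jk3.
      by move=> a /ij1/jk1.
    by move=> a /ij2/jk2.
  + move=> i j; exists (i.1.1 ++ j.1.1, i.1.2 ++ j.1.2, maxn i.2 j.2).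
    split; split=> /=; rewrite ?leq_maxl ?leq_maxr // => a aP;
      by rewrite mem_cat aP ?orbT.
- by move=> i; have [] := pi_P i.
- move=> a B /wot_nbhsP[m [v [e [e0 vB]]]].
  have [k ke] : exists k : nat, k.+1%:R^-1 < e.
    by have [k] := ltr_add_invr e0; rewrite add0r; exists k.
  exists ([:: a], codom (fst \o v) ++ codom (snd \o v), k) => //.
  move=> j [j1 j2 j3]; apply: vB => i.
  have [_ jP] := pi_P j.
  apply: lt_trans (_ : j.2.+1%:R^-1 < e).
    apply: jP; first by rewrite j1 ?mem_head.
      by apply: j2; rewrite mem_cat; apply/orP; left; apply/codomP; exists i.
    by apply: j2; rewrite mem_cat; apply/orP; right; apply/codomP; exists i.
  apply: le_lt_trans ke; by rewrite lef_pV2 ?posrE // ler_nat.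
Qed.

(** * Separation from a convex cone in finite dimension *)

Section ConeSeparation.
Context {R : realType}.

Section RowVectors.
Context {m : nat}.
Implicit Types (u v w p q : 'rV[R]_m) (D : set 'rV[R]_m).

Let dot u v : R := \sum_i u 0 i * v 0 i.

Lemma rdotC u v : dot u v = dot v u.
Proof. by apply: eq_bigr => i _; rewrite mulrC. Qed.
Lemma rdotDl u v w : dot (u + v) w = dot u w + dot v w.
Proof. by rewrite -big_split; apply: eq_bigr => i _; rewrite mxE mulrDl. Qed.
Lemma rdotZl r u w : dot (r *: u) w = r * dot u w.
Proof. by rewrite mulr_sumr; apply: eq_bigr => i _; rewrite mxE mulrA. Qed.
Lemma rdotDr u v w : dot u (v + w) = dot u v + dot u w.
Proof. by rewrite rdotC rdotDl ![dot _ u]rdotC. Qed.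
Lemma rdotZr r u w : dot u (r *: w) = r * dot u w.
Proof. by rewrite rdotC rdotZl rdotC. Qed.
Lemma rdot_ge0 u : 0 <= dot u u.
Proof. by apply: sumr_ge0 => i _; rewrite -expr2 sqr_ge0. Qed.
Lemma rdot_eq0 u : dot u u = 0 -> u = 0.
Proof.
move/eqP; rewrite psumr_eq0 => [/allP u0|i _]; last by rewrite -expr2 sqr_ge0.
apply/rowP => i; rewrite mxE; apply/eqP.
by have := u0 i (mem_index_enum _); rewrite /= mulf_eq0 orbb.
Qed.
Lemma rdot_coord u i : u 0 i ^+ 2 <= dot u u.
Proof.
rewrite /dot (bigD1 i) //= -expr2 lerDl sumr_ge0 // => j _.
by rewrite -expr2 sqr_ge0.
Qed.

Lemma rdot_continuous p : continuous (fun q => dot (q - p) (q - p)).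
Proof.
apply: continuous_big => [|i _ q]; first exact: add_continuous.
have cont : {for q, continuous (fun v : 'rV[R]_m => (v - p) 0 i)}.
  have -> : (fun v : 'rV[R]_m => (v - p) 0 i) = (fun v => v 0 i - p 0 i).
    by apply/funext => v; rewrite !mxE.
  by apply: continuousB; [exact: coord_continuous|exact: cst_continuous].
by apply: continuousM.
Qed.

Lemma closure_stable D (g : 'rV[R]_m -> 'rV[R]_m) : continuous g ->
  (forall u, D u -> D (g u)) -> forall u, closure D u -> closure D (g u).
Proof.
move=> gc gD u Du B /gc Bg; have [w [Dw Bw]] := Du _ Bg.
by exists (g w); split=> //; exact: gD.
Qed.

(** Points of the closure that are no further from [p] than a given [v0] form a
    compact set, on which the distance to [p] attains its minimum. *)
Lemma closure_nearest D p : D !=set0 ->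
  exists2 q, closure D q & forall w, closure D w -> dot (q - p) (q - p) <=
    dot (w - p) (w - p).
Proof.
move=> [v0 Dv0]; pose f q := dot (q - p) (q - p).
pose E := closure D `&` [set q | f q <= f v0].
have Ecl : closed E.
  apply: closedI; first exact: closed_closure.
  by apply: closed_comp (@closed_le R (f v0)) => q _; exact: rdot_continuous.
have Eb : bounded_set E.
  have EF : ProperFilter (globally E) by apply: (globally_properfilter (a := v0));
    split=> /=; [exact: subset_closure|].
  apply/ex_bound; exists (`|p| + (1 + f v0)) => q [_ /= qf].
  rewrite -[q](subrK p) addrC; apply: le_trans (ler_normD _ _) _; rewrite lerD2l.
  rewrite [leLHS]mx_normrE; apply/bigmax_leP; split=> [|[k i] _ /=].
    by rewrite addr_ge0 // rdot_ge0.
  rewrite (ord1 k); have f0 : 0 <= f v0 by exact: rdot_ge0.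
  rewrite -(@ler_pXn2r _ 2) ?nnegrE ?addr_ge0 // real_normK ?num_real //.
  apply: le_trans (rdot_coord _ _) _; apply: le_trans qf _.
  by move: f0; move: (f v0) => r r0; nra.
have E0 : E !=set0 by exists v0; split=> /=; [exact: subset_closure|].
have fE : {within E, continuous f}.
  by apply: continuous_subspaceT => q; exact: rdot_continuous.
have [q] := EVT_min_rV E0 (bounded_closed_compact Eb Ecl) fE.
rewrite inE => -[qE qf] qmin.
exists q => // w wD; have [wf|/ltW fw] := leP (f w) (f v0); last exact: le_trans fw.
by apply: qmin; rewrite inE.
Qed.

(** Let [q] be the point of the closed cone nearest to [p], and [b = p - q].  Moving
    from [q] in a direction [d] of the cone does not approach [p], so
    [dot b d <= 0]; moving along [q] and along [- q] stays in the cone, so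
    [dot b q = 0] and [dot b p = dot b b]. *)
Lemma cone_separation_rV D p : D 0 -> (forall u v, D u -> D v -> D (u + v)) ->
  (forall r u, 0 <= r -> D u -> D (r *: u)) -> ~ closure D p ->
  exists b, (forall d, D d -> dot b d <= 0) /\ 0 < dot b p.
Proof.
move=> D0 DD DZ pD; have [|q qD qmin] := @closure_nearest D p; first by exists 0.
have tD r u : 0 <= r -> closure D u -> closure D (r *: u).
  move=> r0; apply: closure_stable => [v|v]; last exact: DZ.
  by apply: continuousZl_tmp; exact: cvg_id.
have addD d u : D d -> closure D u -> closure D (d + u).
  move=> dD; apply: closure_stable => [v|v]; last exact: DD.
  by apply: continuousD; [exact: cst_continuous|exact: cvg_id].
set b := p - q.
have key d : (forall t, 0 < t -> t <= 1 -> closure D (q + t *: d)) -> dot b d <= 0.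
  move=> H; suff : dot b d *+ 2 <= 0 by move: (dot b d) => x; lra.
  apply: (@le0_small _ _ (dot d d)); first exact: rdot_ge0.
  move=> t t0.
  (* Steps are limited to 1 because [q - t q] leaves the cone for [t > 1]. *)
  pose t' := Num.min t 1.
  have t'0 : 0 < t' by rewrite lt_min t0 ltr01.
  have := qmin _ (H t' t'0 _); rewrite ge_min lexx orbT => /(_ isT).
  have E1 : q + t' *: d - p = t' *: d + (-1) *: b
    by rewrite /b scaleN1r opprB addrA [t' *: d + q]addrC.
  have E2 : q - p = (-1) *: b by rewrite /b scaleN1r opprB.
  clearbody b; rewrite E1 E2 !(rdotDl, rdotDr, rdotZl, rdotZr) (rdotC d b) => le.
  have le' : dot b d *+ 2 <= t' * dot d d.
    rewrite -(@ler_pM2l _ t') // mulr2n; move: le;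
      move: (dot b b) (dot b d) (dot d d) => x y z; nra.
  by apply: le_trans le' _; rewrite ler_wpM2r ?rdot_ge0 // ge_min lexx.
exists b; split=> [d dD|].
  by apply: key => t t0 _; rewrite addrC; apply: addD => //; apply: DZ => //; exact: ltW.
have bq : dot b q = 0.
  apply/eqP; rewrite eq_le; apply/andP; split.
    apply: key => t t0 _; rewrite -[X in X + _]scale1r -scalerDl; apply: tD => //.
    by rewrite addr_ge0 // ltW.
  rewrite -oppr_le0 -[- _]mulN1r -rdotZr; apply: key => t t0 t1.
  rewrite scalerA mulrN1 -[X in X + _]scale1r -scalerDl; apply: tD => //.
  by rewrite subr_ge0.
have b0 : b != 0.
  by apply/eqP => b0; apply: pD; have := qD;
    rewrite -[q](subrK p) -opprB -/b b0 oppr0 add0r.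
have -> : p = b + q by rewrite subrK.
rewrite rdotDr bq addr0 lt_def rdot_ge0 andbT; apply: contra_neq b0; exact: rdot_eq0.
Qed.
End RowVectors.

(** The bipolar theorem, with membership in the closed cone unfolded. *)
Lemma cone_approx (I : finType) (D : set (I -> R)) (p : I -> R) :
  D (fun=> 0) -> (forall d d', D d -> D d' -> D (fun i => d i + d' i)) ->
  (forall r d, 0 <= r -> D d -> D (fun i => r * d i)) ->
  (forall b : I -> R, (forall d, D d -> \sum_i b i * d i <= 0) -> \sum_i b i * p i <= 0)
    ->
  forall e, 0 < e -> exists2 d, D d & forall i, `|d i - p i| < e.
Proof.
move=> D0 DD DZ polar e e0.
pose row (d : I -> R) : 'rV[R]_#|I| := \row_j d (enum_val j).
have [cl|ncl] := pselect (closure [set row d | d in D] (row p)).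
  have [_ [[d Dd <-] [_ de]]] := cl _ (nbhsx_ballx (row p) e e0).
  exists d => // i; have := de 0 (enum_rank i).
  by rewrite /ball /= !mxE !enum_rankK distrC.
have [|||b [bD]] := cone_separation_rV _ _ _ ncl.
- by exists (fun=> 0) => //; apply/rowP => j; rewrite !mxE.
- move=> _ _ [d Dd <-] [d' Dd' <-]; exists (fun i => d i + d' i); first exact: DD.
  by apply/rowP => j; rewrite !mxE.
- move=> r _ r0 [d Dd <-]; exists (fun i => r * d i); first exact: DZ.
  by apply/rowP => j; rewrite !mxE.
have sumE d : \sum_i b 0 i * row d 0 i = \sum_i b 0 (enum_rank i) * d i.
  rewrite (reindex_onto (@enum_val I I) enum_rank) /=; last by move=> i _;
    rewrite enum_rankK.
  by apply: eq_big => [j|j _]; rewrite enum_valK ?eqxx // mxE.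
rewrite sumE ltNge polar // => d Dd; rewrite -sumE; apply: bD.
by exists d.
Qed.

(** A complex coordinate is two real ones, and a real linear functional on complex
    tuples is the real part of a complex linear one. *)
Lemma complex_cone_approx (I : finType) (D : set (I -> R[i])) (p : I -> R[i]) :
  D (fun=> 0) -> (forall d d', D d -> D d' -> D (fun i => d i + d' i)) ->
  (forall (r : R) d, 0 <= r -> D d -> D (fun i => r%:C * d i)) ->
  (forall b : I -> R[i], (forall d, D d -> complex.Re (\sum_i b i * d i) <= 0) ->
     complex.Re (\sum_i b i * p i) <= 0) ->
  forall e, 0 < e -> exists2 d, D d & forall i, cabs (d i - p i) < e.
Proof.
move=> D0 DD DZ polar e e0.
pose co (d : I -> R[i]) (k : I * bool) : R :=
  if k.2 then complex.Re (d k.1) else complex.Im (d k.1).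
have [|||||_ [d Dd <-] de] := @cone_approx _ [set co d | d in D] (co p) _ _ _ _ (e / 2).
- by exists (fun=> 0) => //; apply/funext => -[i []].
- move=> _ _ [d Dd <-] [d' Dd' <-]; exists (fun i => d i + d' i); first exact: DD.
  by apply/funext => -[i []]; rewrite /co /=; case: (d i); case: (d' i).
- move=> r _ r0 [d Dd <-]; exists (fun i => r%:C * d i); first exact: DZ.
  by apply/funext => -[i []]; rewrite /co /=; case: (d i) => a b /=; ring.
- move=> b bD.
  (* The real part of [(u - i v) z] is [u Re z + v Im z]. *)
  pose c i := b (i, true) +i* - b (i, false).
  have sumE d : \sum_k b k * co d k = complex.Re (\sum_i c i * d i).
    pose F i t := b (i, t) * co d (i, t).
    rewrite Re_sum (eq_bigr (fun k => F k.1 k.2)) => [|[]//].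
    rewrite -(pair_bigA _ F) /F /=.
    apply: eq_bigr => i _; rewrite big_bool /co /c /=; case: (d i) => x y /=; ring.
  rewrite sumE; apply: polar => d Dd; rewrite -sumE; apply: bD; by exists d.
- by rewrite divr_gt0.
exists d => // i; have := de (i, true); have := de (i, false); rewrite /co /= => him hre.
rewrite -(@ltr_pXn2r _ 2) ?nnegrE ?cabs_ge0 ?(ltW e0) // cabs_sqrE.
move: him hre; case: (d i) (p i) => [x y] [x' y'] /=.
rewrite !ltr_norml => /andP[h1 h2] /andP[h3 h4]; nra.
Qed.
End ConeSeparation.

(** * Almost orthonormal families and accretive matrices *)

(** Gram-Schmidt changes almost orthonormal vectors little.  The precision [delta]
    depends on the number of vectors but not on the space, which is not known in
    advance when the lemma is applied. *)
Lemma near_orthonormal (R : realType) n (eta : R) : 0 < eta ->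
  exists2 delta : R, 0 < delta & forall (H : hilbertType R) (X : nat -> H),
    (forall i j, (i < n)%N -> (j < n)%N -> cabs (hdot (X i) (X j) - (i == j)%:R) <
      delta) ->
    exists2 W : nat -> H, orthonormal (initseg W n) &
      forall i, (i < n)%N -> rnorm (W i - X i) < eta.
Proof.
elim: n eta => [|n IH] eta eta0.
  by exists 1 => // H X _; exists X => // -[].
pose mu := Num.min eta 1; have mu0 : 0 < mu by rewrite lt_min eta0 ltr01.
have mu_eta : mu <= eta by rewrite ge_min lexx.
have mu_1 : mu <= 1 by rewrite ge_min lexx orbT.
(* The residual of [X n] differs from [X n] by at most [3 n c], its norm
   differs from 1 by at most [3 n c + c], and so normalising it keeps the
   total change below [6 n c + c < mu]. *)
pose c := mu / (8 * n.+1%:R).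
have c0 : 0 < c by rewrite divr_gt0 // mulr_gt0.
have cE : 8 * (n%:R * c) + 8 * c = mu.
  by rewrite /c -[n.+1%:R]natr1; field; rewrite natr1 pnatr_eq0.
have nc0 : 0 <= n%:R * c by rewrite mulr_ge0 // ltW.
have [d d0 Hd] := IH c c0.
exists (Num.min d c); first by rewrite lt_min d0 c0.
move=> H X XX.
have [|W Wo WX] := Hd H X.
  move=> i j iN jN; have := XX i j (leqW iN) (leqW jN).
  by rewrite lt_min => /andP[].
have Xn i : (i <= n)%N -> cabs (hdot (X n) (X i) - (n == i)%:R) < c.
  by move=> iN; have := XX n i (leqnn _) iN; rewrite lt_min => /andP[].
set v := X n; set P := proj (initseg W n) v; set r := rnorm (v - P).
have v2 : `|rnorm v ^+ 2 - 1| < c.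
  have := Xn n (leqnn _);
    rewrite eqxx hdotE -[X in _ - X](rmorph1 (real_complex R)) -rmorphB.
  by rewrite cabsR.
have v0 : 0 <= rnorm v := rnorm_ge0 _.
have v1 : `|rnorm v - 1| < c.
  move: v2 v0; move: (rnorm v) => x; rewrite !ltr_norml => /andP[h1 h2] x0.
  by apply/andP; split; nra.
have Pn : rnorm P <= n%:R * (3 * c).
  apply: le_trans (rnorm_sum _ _ _) _.
  rewrite -[n in n%:R]card_ord mulr_natl -sumr_const; apply: ler_sum => i _.
  rewrite rnormZ rnorm_orthonormal // mulr1 mxE /initseg.
  have -> : hdot v (W i) = hdot v (X i) + hdot v (W i - X i)
    by rewrite -hdotDr addrC subrK.
  apply: le_trans (cabsD _ _) _.
  have h1 := Xn i (ltnW (ltn_ord i)).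
  have h2 := hdot_CS v (W i - X i); have h3 := WX i (ltn_ord i).
  move: h1; rewrite gtn_eqF // subr0 -/v => h1.
  have : rnorm v * rnorm (W i - X i) <= 2 * c.
    apply: ler_pM; rewrite ?rnorm_ge0 // ?ltW //.
    move: v1; rewrite ltr_norml => /andP[_]; lra.
  lra.
have Pge := rnorm_ge0 P.
have r1 : rnorm v - rnorm P <= r.
  by rewrite lerBlDr; have := rnormD (v - P) P; rewrite subrK.
have r2 : r <= rnorm v + rnorm P.
  by have := rnormD v (- P); rewrite rnormN.
have rpos : 0 < r.
  move: v1; rewrite ltr_norml => /andP[h1 h2]; nra.
have [|g [go gW _ gN]] := @orthonormal_extend1 _ _ W n v Wo.
  by move=> Pv; move: rpos; rewrite /r /P Pv subrr rnorm0 ltxx.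
exists g => // i; rewrite ltnS leq_eqVlt => /predU1P[->|iN]; last first.
  by rewrite gW //; apply: lt_trans (WX i iN) _; lra.
have -> : g n - X n = ((r^-1)%:C - 1) *: (v - P) - P.
  by rewrite gN scalerBl scale1r -[RHS]addrA -opprD subrK.
apply: le_lt_trans (rnormD _ _) _; rewrite rnormN rnormZ -/r.
have -> : cabs ((r^-1)%:C - 1) * r = `|1 - r|.
  rewrite -[1 in X in cabs X](rmorph1 (real_complex R))
    -rmorphB cabsR -[X in _ * X](ger0_norm (ltW rpos)).
  by rewrite -normrM mulrBl mulVf ?mul1r // gt_eqF.
have : `|1 - r| <= c + rnorm P.
  by move: v1; rewrite ltr_norml ler_norml => /andP[h1 h2]; apply/andP; split; lra.
by lra.
Qed.

Section Accretive.
Context {R : realType} {K : hilbertType R} (A : unitalOpAlg K).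

(** The number <rho^(n)(B) X, X>, with [X] seen as one vector of (C^N)^n. *)
Definition mxform N (rho : A -> 'M[R[i]]_N) n (B : 'M[A]_n) (X : 'I_n -> 'cV[R[i]]_N) :
  R[i] :=
  \sum_i \sum_j edot (rho (B i j) *m X j) (X i).

Lemma mxdual_fun_linear n (phi : 'M[dual A]_n) : linear (mxdual_fun phi).
Proof.
move=> c a b; apply/matrixP => i j; rewrite !mxE.
have /asboolP[phil _] := dual_funP (phi i j); exact: phil.
Qed.

Lemma sum_euclnorm_sqrD N n (t : R) (X Y : 'I_n -> 'cV[R[i]]_N) :
  \sum_i euclnorm (X i + t%:C *: Y i) ^+ 2 =
  \sum_i euclnorm (X i) ^+ 2 + complex.Re (\sum_i edot (Y i) (X i)) * t *+ 2
  + t ^+ 2 * \sum_i euclnorm (Y i) ^+ 2.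
Proof.
rewrite Re_sum mulr_suml -sumrMnl mulr_sumr -!big_split; apply: eq_bigr => i _ /=.
have := @rnorm_sqrD R (eucl N) (X i) (t%:C *: (Y i : eucl N)).
rewrite rnormZ cabsR hdotZr exprMn real_normK ?num_real // !rnorm_eucl => ->.
congr (_ + _ *+ 2 + _).
by rewrite conjc_real ReM mulrC; congr (_ * _); rewrite hdot_conj ReJ.
Qed.

(** The element 1 + t B of M_n(A). *)
Definition perturb_unit n (t : R) (B : 'M[A]_n) : 'M[A]_n :=
  \matrix_(i, j) ((i == j)%:R%:C *: (1 : A) + t%:C *: (B i j : A) : A).

Lemma perturb_unit_act N (rho : A -> 'M[R[i]]_N) n t (B : 'M[A]_n)
  (X : 'I_n -> 'cV[R[i]]_N) i :
  linear rho -> rho 1 = 1%:M ->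
  \sum_j rho (perturb_unit t B i j) *m X j = X i + t%:C *: \sum_j rho (B i j) *m X j.
Proof.
move=> rhol rho1.
have rE j : rho (perturb_unit t B i j) = ((i == j)%:R%:C)%:M + t%:C *: rho (B i j).
  have r0 : rho 0 = 0.
    by have := rhol 1 0 0; rewrite !scale1r addr0 => /esym/eqP;
      rewrite -subr_eq0 addrK => /eqP.
  have rZ c a : rho (c *: a) = c *: rho a by have := rhol c a 0; rewrite r0 !addr0.
  by rewrite mxE rhol rho1 rZ scalemx1.
under eq_bigr do rewrite rE mulmxDl mul_scalar_mx -scalemxAl.
rewrite big_split /= -scaler_sumr; congr (_ + _).
rewrite (bigD1 i) //= eqxx scale1r big1 ?addr0 // => j ji.
by rewrite eq_sym (negPf ji) scale0r.
Qed.

(** A nonpositive real part is visible in norms: it gives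
    [|| 1 + t rho(B) ||^2 <= 1 + t^2 || B ||^2].  Residual finite dimensionality
    carries the bound to [1 + t B] and complete contractivity to [1 + t phi(B)].
    Testing on the vector (e_1, .., e_n), whose square norm is [n], and letting [t]
    tend to 0 gives the claim. *)
Lemma accretive_state n (B : 'M[A]_n) (phi : 'M[dual A]_n) : rfd A ->
  (forall N (rho : {linear A -> 'M[R[i]]_N}) X, mxrep rho ->
     complex.Re (mxform rho B X) <= 0) ->
  matrix_states phi -> complex.Re (\sum_i \sum_j phi i j (B i j)) <= 0.
Proof.
move=> Arfd Bacc [phi1 phic].
set beta := oa_mxnorm B.
set r := complex.Re _.
have C0 : 0 <= beta ^+ 2 * n%:R by apply: mulr_ge0 => //; exact: sqr_ge0.
suff : r *+ 2 <= 0 by move: r => x; lra.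
apply: (@le0_small _ _ (beta ^+ 2 * n%:R)) => // t t0.
have S0 : 0 <= 1 + t ^+ 2 * beta ^+ 2.
  by apply: addr_ge0 => //; apply: mulr_ge0; exact: sqr_ge0.
have rhoT N (rho : {linear A -> 'M[R[i]]_N}) : mxrep rho ->
    cmx_mxnorm (map_mx rho (perturb_unit t B)) <= Num.sqrt (1 + t ^+ 2 * beta ^+ 2).
  move=> rhor; have [rhoM rho1 rhoc] := rhor.
  apply: cmx_mxnorm_le; first exact: sqrtr_ge0.
  move=> X; rewrite sqr_sqrtr //.
  pose Y i := \sum_j rho (B i j) *m X j.
  rewrite (eq_bigr (fun i => euclnorm (X i + t%:C *: Y i) ^+ 2)) => [|i _]; last first.
    rewrite -perturb_unit_act //; last exact: linearP.
    by congr (euclnorm _ ^+ 2); apply: eq_bigr => j _; rewrite mxE.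
  rewrite sum_euclnorm_sqrD mulrDl mul1r -addrA lerD2l.
  rewrite -[leRHS]add0r lerD //.
    rewrite pmulrn_lle0 // pmulr_lle0 //; apply: le_trans (Bacc _ rho X rhor).
    rewrite le_eqVlt; apply/orP; left; apply/eqP; congr complex.Re.
    apply: eq_bigr => i _; rewrite -(hdot_suml (H := eucl N)); by [].
  rewrite -[leRHS]mulrA ler_wpM2l ?sqr_ge0 //.
  have := cmx_mxnorm_ub (map_mx rho B) X.
  rewrite (eq_bigr (fun i => euclnorm (Y i) ^+ 2)) => [|i _]; last first.
    by congr (euclnorm _ ^+ 2); apply: eq_bigr => j _; rewrite mxE.
  move/le_trans; apply; rewrite ler_wpM2r ?sum_sqr_ge0 //.
  by rewrite ler_pXn2r ?nnegrE ?cmx_mxnorm_ge0 ?bop_mxnorm_ge0 ?rhoc.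
have AT : oa_mxnorm (perturb_unit t B) <= Num.sqrt (1 + t ^+ 2 * beta ^+ 2).
  rewrite Arfd; apply: ge_sup; first exact: fd_norms0.
  move=> _ [H [pi [Hfd pir ->]]].
  have [|N [e [eo rhor piE]]] := rep_frame pir.
    by have [k [u uP]] := Hfd; exists k, u => x _; exact: uP.
  apply: le_trans (rhoT _ _ rhor).
  apply: le_trans (bop_mxnorm_expand eo _).
  rewrite -map_mx_comp le_eqVlt; apply/orP; left; apply/eqP; congr bop_mxnorm.
  by apply/matrixP => i j; rewrite !mxE /= -piE.
have := le_trans (phic _ (perturb_unit t B)) AT.
set T := map_mx _ _ => Tle.
pose E (j : 'I_n) : 'cV[R[i]]_n := delta_mx j 0.
have EE i : euclnorm (E i) ^+ 2 = 1.
  rewrite euclnorm_sqr (bigD1 i) //= big1 => [|j ji].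
    by rewrite mxE !eqxx addr0 cabsR normr1 expr1n.
  by rewrite mxE (negPf ji) cabs0 expr0n.
have sE : \sum_i euclnorm (E i) ^+ 2 = n%:R.
  by under eq_bigr do rewrite EE; rewrite sumr_const card_ord.
pose Y i := \sum_j mxdual_fun phi (B i j) *m E j.
have := cmx_mxnorm_ub T E.
rewrite (eq_bigr (fun i => euclnorm (E i + t%:C *: Y i) ^+ 2)) => [|i _]; last first.
  rewrite -perturb_unit_act //; last exact: mxdual_fun_linear.
  by congr (euclnorm _ ^+ 2); apply: eq_bigr => j _; rewrite mxE.
rewrite sum_euclnorm_sqrD sE => le1.
have rE : complex.Re (\sum_i edot (Y i) (E i)) = r.
  rewrite /r; congr complex.Re; apply: eq_bigr => i _.
  rewrite /edot (bigD1 i) //= big1 => [|j ji]; last first.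
    by rewrite [E i j 0]mxE (negPf ji) conjc0 mulr0.
  rewrite [E i i 0]mxE !eqxx conjc1 mulr1 addr0 summxE; apply: eq_bigr => j _.
  by rewrite -colE !mxE.
have le2 : cmx_mxnorm T ^+ 2 * n%:R <= (1 + t ^+ 2 * beta ^+ 2) * n%:R.
  rewrite ler_wpM2r // -[leRHS]sqr_sqrtr //.
  by rewrite ler_pXn2r ?nnegrE ?cmx_mxnorm_ge0 ?sqrtr_ge0.
have := le_trans le1 le2; rewrite rE mulrDl mul1r -addrA lerD2l => le3.
have Y0 : 0 <= t ^+ 2 * \sum_i euclnorm (Y i) ^+ 2.
  exact: mulr_ge0 (sqr_ge0 _) (sum_sqr_ge0 _).
rewrite -(@ler_pM2l _ t) //.
have {}le3 : r * t *+ 2 <= t ^+ 2 * beta ^+ 2 * n%:R.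
  by apply: le_trans le3; rewrite lerDl.
by rewrite [leLHS]mulrnAr [t * r]mulrC; apply: le_trans le3 _; rewrite expr2 !mulrA.
Qed.
End Accretive.

(** * Density of finite dimensional matrix states *)

Section DirectSum.
Context {R : realType} {K : hilbertType R} (A : unitalOpAlg K).

Definition dsum N M (rho : {linear A -> 'M[R[i]]_N}) (sigma : {linear A -> 'M[R[i]]_M})
  (a : A) : 'M[R[i]]_(N + M) := block_mx (rho a) 0 0 (sigma a).

Lemma dsum_linear N M (rho : {linear A -> 'M[R[i]]_N})
  (sigma : {linear A -> 'M[R[i]]_M}) :
  linear (dsum rho sigma).
Proof.
move=> c a b; rewrite /dsum !linearP scale_block_mx add_block_mx.
by rewrite !scaler0 !addr0.
Qed.
HB.instance Definition _ N M (rho : {linear A -> 'M[R[i]]_N})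
  (sigma : {linear A -> 'M[R[i]]_M}) :=
  GRing.isLinear.Build _ _ _ _ (dsum rho sigma) (dsum_linear rho sigma).

Lemma edot_col_mx N M (u v : 'cV[R[i]]_N) (u' v' : 'cV[R[i]]_M) :
  edot (col_mx u u') (col_mx v v') = edot u v + edot u' v'.
Proof.
rewrite /edot big_split_ord /=; congr (_ + _); apply: eq_bigr => i _.
  by rewrite !col_mxEu.
by rewrite !col_mxEd.
Qed.

Lemma euclnorm_col_mx N M (u : 'cV[R[i]]_N) (u' : 'cV[R[i]]_M) :
  euclnorm (col_mx u u') ^+ 2 = euclnorm u ^+ 2 + euclnorm u' ^+ 2.
Proof.
rewrite !euclnorm_sqr big_split_ord /=; congr (_ + _); apply: eq_bigr => i _.
  by rewrite !col_mxEu.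
by rewrite !col_mxEd.
Qed.

Lemma dsum_mul N M (rho : {linear A -> 'M[R[i]]_N}) (sigma : {linear A -> 'M[R[i]]_M})
  a u v :
  dsum rho sigma a *m col_mx u v = col_mx (rho a *m u) (sigma a *m v) :> 'cV_(N + M).
Proof. by rewrite mul_block_col !mul0mx addr0 add0r. Qed.

Lemma mxrep_dsum N M (rho : {linear A -> 'M[R[i]]_N}) (sigma : {linear A -> 'M[R[i]]_M}) :
  mxrep rho -> mxrep sigma -> mxrep (dsum rho sigma).
Proof.
move=> [rhoM rho1 rhoc] [sigM sig1 sigc]; split=> [a b||n a].
- by rewrite /= /dsum mulmx_block rhoM sigM !mul0mx !mulmx0 !addr0 !add0r.
- by rewrite /= /dsum rho1 sig1 -scalar_mx_block.
- apply: cmx_mxnorm_le; first exact: bop_mxnorm_ge0.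
  move=> x; pose u i := usubmx (x i); pose v i := dsubmx (x i).
  have xE i : x i = col_mx (u i) (v i) by rewrite vsubmxK.
  rewrite [in leRHS](eq_bigr (fun i => euclnorm (u i) ^+ 2 + euclnorm (v i) ^+ 2));
    last first.
    by move=> i _; rewrite xE euclnorm_col_mx.
  rewrite [leLHS](eq_bigr (fun i => euclnorm (\sum_j map_mx rho a i j *m u j) ^+ 2
     + euclnorm (\sum_j map_mx sigma a i j *m v j) ^+ 2)) => [|i _]; last first.
    rewrite -euclnorm_col_mx; congr (euclnorm _ ^+ 2).
    rewrite (eq_bigr
      (fun j => col_mx (map_mx rho a i j *m u j) (map_mx sigma a i j *m v j))).
      apply/colP => k; rewrite summxE -[k]splitK /=; case: (fintype.split k) => l /=.
        rewrite col_mxEu summxE; by apply: eq_bigr => j _; rewrite col_mxEu.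
      rewrite col_mxEd summxE; by apply: eq_bigr => j _; rewrite col_mxEd.
    by move=> j _; rewrite !mxE xE dsum_mul.
  have le k (tau : {linear A -> 'M[R[i]]_k}) (y : 'I_n -> 'cV[R[i]]_k) :
      cmx_mxnorm (map_mx tau a) <= oa_mxnorm a ->
      \sum_i euclnorm (\sum_j map_mx tau a i j *m y j) ^+ 2 <=
      oa_mxnorm a ^+ 2 * \sum_i euclnorm (y i) ^+ 2.
    move=> tauc; apply: le_trans (cmx_mxnorm_ub _ _) _.
    rewrite ler_wpM2r ?sum_sqr_ge0 //.
    by rewrite ler_pXn2r ?nnegrE ?cmx_mxnorm_ge0 ?bop_mxnorm_ge0.
  by rewrite !big_split /= mulrDr lerD ?le.
Qed.
End DirectSum.

Section RFDtoDense.
Context {R : realType} {K : hilbertType R} (A : unitalOpAlg K).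

Lemma big_triple (V : nmodType) p n (F : 'I_p * ('I_n * 'I_n) -> V) :
  \sum_k F k = \sum_i \sum_j \sum_l F (l, (i, j)).
Proof.
transitivity (\sum_l \sum_q F (l, q)).
  by rewrite (pair_bigA _ (fun l q => F (l, q))); apply: eq_bigr => -[].
rewrite exchange_big /=.
by rewrite (pair_bigA _ (fun i j => \sum_l F (l, (i, j)))); apply: eq_bigr => -[].
Qed.

Lemma dual_comb (phi : dual A) (I : finType) (c : I -> R[i]) (a : I -> A) :
  phi (\sum_l c l *: a l) = \sum_l c l * phi (a l).
Proof.
have /asboolP[phil _] := dual_funP phi.
elim/big_rec2: _ => [|l x y _ <-]; last exact: phil.
by apply: (addrI (phi 0)); have := phil 1 0 0; rewrite scale1r mul1r addr0 => <-;
  rewrite addr0.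
Qed.

(** These vector functionals form a convex cone, thanks to direct sums of matrix
    representations, and [accretive_state] says that [phi] is in its bipolar.  The
    family [X] is arbitrary, so nothing ensures that it is orthonormal. *)
Lemma rfd_vector_approx n (phi : 'M[dual A]_n) (s : seq A) (e : R) :
  rfd A -> matrix_states phi -> 0 < e ->
  exists N (rho : {linear A -> 'M[R[i]]_N}) (X : 'I_n -> 'cV[R[i]]_N), mxrep rho /\
    forall a i j, a \in s -> cabs (edot (rho a *m X j) (X i) - phi i j a) < e.
Proof.
move=> Arfd phiS e0.
pose a_ := tnth (in_tuple s).
pose I := ('I_(size s) * ('I_n * 'I_n))%type.
pose vec N (rho : {linear A -> 'M[R[i]]_N}) (X : 'I_n -> 'cV[R[i]]_N) (k : I) : R[i] :=
  edot (rho (a_ k.1) *m X k.2.2) (X k.2.1).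
pose D := [set d : I -> R[i] | exists N (rho : {linear A -> 'M[R[i]]_N}) X,
  mxrep rho /\ d = vec N rho X].
have [|||||_ [N [rho [X [rhor ->]]]] de] :=
    @complex_cone_approx R I D (fun k => phi k.2.1 k.2.2 (a_ k.1)) _ _ _ _ e;
      last 1 first.
- by exists N, rho, X; split=> // a i j /(tnthP (in_tuple s))[k ->];
    exact: (de (k, (i, j))).
- exists 0%N, \0, (fun=> 0); split; first exact: mxrep_zero.
  by apply/funext => k; rewrite /vec /edot big_ord0.
- move=> _ _ [N [rho [X [rhor ->]]]] [M [sigma [Y [sigr ->]]]].
  exists (N + M)%N, (dsum rho sigma), (fun i => col_mx (X i) (Y i)).
  split; first exact: mxrep_dsum.
  by apply/funext => k; rewrite /vec dsum_mul edot_col_mx.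
- move=> r _ r0 [N [rho [X [rhor ->]]]].
  exists N, rho, (fun i => (Num.sqrt r)%:C *: X i); split=> //.
  apply/funext => k; rewrite /vec -scalemxAr.
  rewrite -!/(@hdot R (eucl N) _ _)
    hdotZl hdotZr conjc_real mulrA -rmorphM -expr2 sqr_sqrtr //.
- move=> b bD.
  pose B : 'M[A]_n := \matrix_(i, j) \sum_l b (l, (i, j)) *: (a_ l : A).
  have -> : \sum_k b k * phi k.2.1 k.2.2 (a_ k.1) = \sum_i \sum_j phi i j (B i j).
    rewrite big_triple; apply: eq_bigr => i _; apply: eq_bigr => j _.
    by rewrite mxE dual_comb.
  apply: accretive_state => // N rho X rhor.
  have -> : mxform rho B X = \sum_k b k * vec N rho X k; last by apply: bD;
    exists N, rho, X.
  rewrite big_triple; apply: eq_bigr => i _; apply: eq_bigr => j _.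
  rewrite mxE linear_sum mulmx_suml -/(@hdot R (eucl N) _ _) hdot_suml.
  by apply: eq_bigr => l _; rewrite linearZ /= -scalemxAl -/(@hdot R (eucl N) _ _) hdotZl.
- exact: e0.
Qed.

(** The isometry of the state is the one that sends the standard basis to [W]. *)
Lemma fin_dim_state_of_frame N n (rho : {linear A -> 'M[R[i]]_N}) (W : 'I_n -> eucl N) :
  mxrep rho -> orthonormal W ->
  exists2 psi : 'M[dual A]_n, fin_dim_matrix_states psi &
    forall a i j, psi i j a = edot (rho a *m W j) (W i).
Proof.
move=> rhor Wo; pose pi := expand (@std_basis R N) \o rho.
have pir : representation pi by have [] := mxrep_expand (@std_basis_on R N) rhor.
have pi1 : pi 1 = 1.
  apply: val_inj; apply/funext => x; have [_ rho1 _] := rhor.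
  by rewrite [LHS]expand_std rho1 mul1mx.
have [|psi psiS psiE] := compress_state pir Wo; first by move=> i;
  exact: (congr1 (fun T : bop _ => T (W i)) pi1).
exists psi; last first.
  move=> a i j; have := congr1 (fun M : 'M[R[i]]_n => M i j) (psiE a).
  by rewrite !mxE => ->; rewrite [pi a _]expand_std.
split=> //; exists (eucl N), (uncoords W), (coords W), pi; split.
- exact: eucl_fin_dim.
- exact: rnorm_uncoords.
- by move=> v x; rewrite hdot_uncoords.
- by split.
- by move=> a v; rewrite psiE compress_mul.
Qed.

(** Approximating [phi] at 1 as well makes the Gram matrix of [X] close to the
    identity, so that [X] can be replaced by an orthonormal family [W]. *)
Lemma rfd_dense : rfd A -> fin_dim_matrix_states_dense A.
Proof.
move=> Arfd n _ phi phiS B /mxdual_nbhsP[s [e [e0 sB]]].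
pose L := \sum_(a <- s) opnorm a.
have L0 : 0 <= L by rewrite sumr_ge0 // => a _; exact: opnorm_ge0.
have aL (a : A) : a \in s -> opnorm a <= L.
  by move=> aS; rewrite /L (big_rem a) //= lerDl sumr_ge0 // => b _; exact: opnorm_ge0.
(* With [eta <= 1], replacing [X] by [W] moves each entry at [a] by at most
   [3 * eta * opnorm a], which should stay below [e / 2]. *)
pose eta := Num.min 1 (e / (6 * (L + 1))).
have L1 : 0 < L + 1 by rewrite ltr_wpDl.
have eta0 : 0 < eta by rewrite lt_min ltr01 divr_gt0 // mulr_gt0.
have eta1 : eta <= 1 by rewrite ge_min lexx.
have etaL : 3 * eta * L <= e / 2.
  have : eta <= e / (6 * (L + 1)) by rewrite ge_min lexx orbT.
  rewrite ler_pdivlMr ?mulr_gt0 //; have := mulr_ge0 (ltW eta0) L0; lra.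
have [delta delta0 Hdelta] := near_orthonormal n eta0.
have [|N [rho [X [rhor rhoX]]]] :=
  rfd_vector_approx (1 :: s) (e := Num.min delta (e / 2)) Arfd phiS.
  by rewrite lt_min delta0 divr_gt0.
pose Xn (i : nat) : eucl N := if insub i is Some j then X j else 0.
have XnE (i : 'I_n) : Xn i = X i by rewrite /Xn valK.
have [|W Wo WX] := Hdelta (eucl N) Xn.
  move=> i j iN jN; have := rhoX 1 (Ordinal jN) (Ordinal iN) (mem_head _ _).
  have [_ -> _] := rhor; rewrite mul1mx -(XnE (Ordinal iN)) -(XnE (Ordinal jN)) /=.
  have := congr1 (fun M : 'M[R[i]]_n => M (Ordinal jN) (Ordinal iN)) phiS.1.
  rewrite !mxE => ->; rewrite lt_min => /andP[+ _].
  by rewrite -(inj_eq val_inj) /= eq_sym.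
have [psi psiS psiE] := fin_dim_state_of_frame rhor Wo.
exists psi; split=> //; apply: sB => a i j aS.
have rho_bd (x : eucl N) : rnorm (rho a *m x : eucl N) <= opnorm a * rnorm x.
  have := rep_bounded (mxrep_expand (@std_basis_on R N) rhor).1 a x.
  by rewrite [X in rnorm X]expand_std.
have WXi (k : 'I_n) : rnorm (W k - X k : eucl N) < eta by have := WX k (ltn_ord k);
  rewrite XnE.
have W1 (k : 'I_n) : rnorm (W k) = 1 by exact: (rnorm_orthonormal Wo k).
have X2 (k : 'I_n) : rnorm (X k : eucl N) <= 2.
  have := rnormD (W k) (X k - W k : eucl N); rewrite addrC subrK W1 rnormB.
  have := WXi k; lra.
rewrite psiE /initseg.
have -> : edot (rho a *m W j) (W i) - phi i j a =
   hdot (rho a *m (W j - X j) : eucl N) (W i) + hdot (rho a *m X j : eucl N) (W i - X i)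
   + (edot (rho a *m X j) (X i) - phi i j a).
  rewrite mulmxBr hdotBl hdotBr addrA addrA !subrK //.
have h3 := rhoX a i j (mem_behead (s := 1 :: s) aS).
rewrite lt_min in h3; case/andP: h3 => _ h3.
have h1 := hdot_CS (rho a *m (W j - X j) : eucl N) (W i).
have h2 := hdot_CS (rho a *m X j : eucl N) (W i - X i).
have := cabsD (hdot (rho a *m (W j - X j) : eucl N) (W i))
  (hdot (rho a *m X j : eucl N) (W i - X i)).
have b1 := rho_bd (W j - X j); have b2 := rho_bd (X j).
rewrite W1 mulr1 in h1.
have c1 : cabs (hdot (rho a *m (W j - X j) : eucl N) (W i)) <= L * eta.
  apply: le_trans h1 _; apply: le_trans b1 _.
  by rewrite ler_pM ?opnorm_ge0 ?rnorm_ge0 ?aL // ltW.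
have c2 : cabs (hdot (rho a *m X j : eucl N) (W i - X i)) <= L * 2 * eta.
  apply: le_trans h2 _; rewrite ler_pM ?rnorm_ge0 ?(ltW (WXi i)) //.
  apply: le_trans b2 _; by rewrite ler_pM ?opnorm_ge0 ?rnorm_ge0 ?aL.
move=> c3; apply: le_lt_trans (cabsD _ _) _; lra.
Qed.

End RFDtoDense.

(** * Equivalence of the three conditions *)

Theorem theorem1p2 (R : realType) (K : hilbertType R) (A : unitalOpAlg K) :
  (rfd A <-> fin_dim_matrix_states_dense A) /\
  (fin_dim_matrix_states_dense A <-> wot_approximable A).
Proof.
split; split; first exact: rfd_dense.
- by move=> dns; exact/wot_approximable_rfd/dense_wot_approximable.
- exact: dense_wot_approximable.
- by move=> wA; exact/rfd_dense/wot_approximable_rfd.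
Qed.
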